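(* Let $\Gamma$ be a non-elementary hyperbolic group. For any $\rho\in\mathscr{D}_\Gamma$ and $\rho_\infty\in\partial_M\mathscr{D}_\Gamma$, there exists some $\rho_*\in\mathscr{D}_\Gamma$ (with $\rho_*\neq\rho$) such that $\rho_\infty=\sigma_\infty^{\rho_*/\rho}$. Moreover, if $\rho'_*\in\mathscr{D}_\Gamma$ satisfies $\rho_\infty=\sigma_\infty^{\rho'_*/\rho}$, then $\rho'_*\in\sigma^{\rho_*/\rho}(0,\infty)=\{\sigma_t^{\rho_*/\rho}:t>0\}$.
   Context: $\Gamma$ is a non-elementary (i.e. not virtually cyclic) Gromov hyperbolic group with identity element $o$. A pseudo metric $d$ on $\Gamma$ is a symmetric function $d:\Gamma\times\Gamma\to[0,\infty)$ satisfying the triangle inequality and $d(x,x)=0$. Its Gromov product is $(x|y)_{z,d}=\frac12(d(x,z)+d(z,y)-d(x,y))$. It is hyperbolic if there is $\delta\ge0$ with $(x|y)_{z,d}\ge\min\{(x|w)_{z,d},(w|y)_{z,d}\}-\delta$ for all $x,y,z,w\in\Gamma$. $\mathcal{D}_\Gamma$ is the set of all left-invariant hyperbolic pseudo metrics on $\Gamma$ that are quasi-isometric (via the identity map) to a word metric for a finite symmetric generating set. $h(d)=\limsup_{n\to\infty}\frac1n\log\#\{x\in\Gamma:d(o,x)<n\}$. $\overline{\mathcal{D}}_\Gamma$ is the set of all left-invariant pseudo metrics $d$ on $\Gamma$ whose stable translation length $\ell_d[x]=\lim_{n\to\infty}\frac1n d(o,x^n)$ is non-constant and for which there are $\lambda>0$,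 $d_0\in\mathcal{D}_\Gamma$ with $(x|y)_{o,d}\le\lambda(x|y)_{o,d_0}+\lambda$ for all $x,y\in\Gamma$. $\partial_M\mathcal{D}_\Gamma=\overline{\mathcal{D}}_\Gamma\setminus\mathcal{D}_\Gamma$. Two real functions $f,g$ on $\Gamma\times\Gamma$ are roughly similar if $|\tau f-g|\le C$ for some $\tau,C>0$. $\mathscr{D}_\Gamma$ and $\partial_M\mathscr{D}_\Gamma$ are the quotients of $\mathcal{D}_\Gamma$ and $\partial_M\mathcal{D}_\Gamma$ by rough similarity. For $d,d_*\in\mathcal{D}_\Gamma$, $\mathrm{Dil}(d,d_* )=\sup_{[x]}\frac{\ell_d[x]}{\ell_{d_*}[x]}$ over conjugacy classes of non-torsion elements; $\mathscr{D}_\Gamma$ has the metric $\Delta([d],[d_*])=\log(\mathrm{Dil}(d,d_* )\mathrm{Dil}(d_*,d))$. Manhattan geodesics: for $d,d_*\in\mathcal{D}_\Gamma$ with $\rho=[d]\ne\rho_*=[d_*]$, let $\theta(t)$ be the abscissa of convergence in $s$ of $\sum_{x\in\Gamma}e^{-td_*(o,x)-sd(o,x)}$. For each $t\in\mathbb{R}$ there is a pseudo metric in $\mathcal{D}_\Gamma$ at bounded distance from $td_*+\theta(t)d$; let $\rho_t^{d_*/d}\in\mathscr{D}_\Gamma$ be its class. The map $t\mapsto\rho_t^{d_*/d}$ is continuous and injective, with $\rho_0^{d_*/d}=\rho$, $\rho_{h(d_* )}^{d_*/d}=\rho_*$, $\Delta$ is additive along it, and both ends are at infinite distance. The Manhattan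 geodesic $\sigma_\bullet^{\rho_*/\rho}:\mathbb{R}\to\mathscr{D}_\Gamma$ is its arc-length reparametrization with $\sigma_0^{\rho_*/\rho}=\rho$ and $\sigma^{\rho_*/\rho}_{\Delta(\rho,\rho_* )}=\rho_*$; it does not depend on the representatives. Its limit at infinity $\sigma_\infty^{\rho_*/\rho}\in\partial_M\mathscr{D}_\Gamma$ is the unique class all of whose representatives are roughly similar to $\mathrm{Dil}(d,d_* )d_*-d$. *)

(* Defs.v *)
From HB Require Import structures.
From mathcomp Require Import all_boot all_order all_algebra.
From mathcomp Require Import all_classical all_reals all_analysis.

Set Implicit Arguments.
Unset Strict Implicit.
Unset Printing Implicit Defensive.

Import Order.TTheory GRing.Theory Num.Theory.
Import numFieldNormedType.Exports.

Local Open Scope classical_set_scope.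
Local Open Scope ring_scope.

(* Some cyclic subgroup <g> has finite index: finitely many left cosets c<g>
   cover G. *)
Definition virtually_cyclic (G : groupType) : Prop :=
  exists (g : G) (F : set G), finite_set F /\
    forall x : G, exists c, F c /\
      exists n : nat, x = (c * g ^+ n)%g \/ x = (c * g ^- n)%g.

Section ManhattanGeodesics.
Context {R : realType} {G : groupType}.

Implicit Types (d dstar : G -> G -> R) (rho rhostar : set (G -> G -> R)).

Definition is_pseudo_metric d : Prop :=
  [/\ forall x y, 0 <= d x y,
      forall x, d x x = 0,
      forall x y, d x y = d y x
    & forall x y z, d x z <= d x y + d y z].

Definition left_invariant d : Prop :=
  forall z x y, d (z * x)%g (z * y)%g = d x y.

Definition gromov_product d (z x y : G) : R :=
  (d x z + d z y - d x y) / 2.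

Definition is_hyperbolic d : Prop :=
  exists2 delta : R, 0 <= delta &
    forall x y z w : G,
      Num.min (gromov_product d z x w) (gromov_product d z w y) - delta
        <= gromov_product d z x y.

Definition words (S : set G) (x : G) : set (seq G) :=
  [set w | (forall s, s \in w -> S s) /\ (\prod_(s <- w) s)%g = x].

Definition finite_symmetric_generating (S : set G) : Prop :=
  [/\ finite_set S,
      forall s, S s -> S (s^-1)%g
    & forall x, words S x !=set0].

(* The infimum is a minimum, as it ranges over a nonempty set of naturals when
   S generates. *)
Definition word_metric (S : set G) (x y : G) : R :=
  inf [set (size w)%:R | w in words S (x^-1 * y)%g].

Definition quasi_isometric_id d d' : Prop :=
  exists L c : R, [/\ 1 <= L, 0 <= c &
    forall x y, L^-1 * d' x y - c <= d x y /\ d x y <= L * d' x y + c].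

Definition metricsD : set (G -> G -> R) :=
  [set d | [/\ is_pseudo_metric d, left_invariant d, is_hyperbolic d &
    exists2 S, finite_symmetric_generating S &
      quasi_isometric_id d (word_metric S)]].

Definition translation_length d (x : G) : R :=
  limn (fun n : nat => n%:R^-1 * d 1%g (x ^+ n)%g).

Definition closureD : set (G -> G -> R) :=
  [set d | [/\ is_pseudo_metric d, left_invariant d,
    exists x y, translation_length d x != translation_length d y &
    exists (lambda : R) d0, [/\ 0 < lambda, metricsD d0 &
      forall x y, gromov_product d 1%g x y
                    <= lambda * gromov_product d0 1%g x y + lambda]]].

Definition boundaryD : set (G -> G -> R) := closureD `\` metricsD.

Definition roughly_similar (f g : G -> G -> R) : Prop :=
  exists tau C : R, [/\ 0 < tau, 0 < C &
    forall x y, `|tau * f x y - g x y| <= C].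

(* The quotient of a set A of pseudo metrics by rough similarity, as the set
   of equivalence classes. *)
Definition rough_class (A : set (G -> G -> R)) d : set (G -> G -> R) :=
  [set d' | A d' /\ roughly_similar d d'].

Definition rough_quotient (A : set (G -> G -> R)) : set (set (G -> G -> R)) :=
  [set rough_class A d | d in A].

Definition scrD : set (set (G -> G -> R)) := rough_quotient metricsD.

Definition boundary_scrD : set (set (G -> G -> R)) := rough_quotient boundaryD.

Definition non_torsion (x : G) : Prop :=
  forall n : nat, (0 < n)%N -> (x ^+ n)%g <> 1%g.

(* The translation length only depends on the conjugacy class, so the supremum
   may be indexed by elements. *)
Definition dil d dstar : R :=
  sup [set translation_length d x / translation_length dstar x
      | x in non_torsion].

(* The value does not depend on the representatives. *)
Definition Delta rho rhostar : R :=
  let d := xget (fun _ _ => 0) rho in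
  let dstar := xget (fun _ _ => 0) rhostar in
  ln (dil d dstar * dil dstar d).

(* Abscissa of convergence in s of \sum_x exp(- t dstar(o,x) - s d(o,x)). *)
Definition manhattan_theta dstar d (t : R) : R :=
  inf [set s : R | (\esum_(x in [set: G])
         (expR (- t * dstar 1%g x - s * d 1%g x))%:E < +oo)%E].

Definition bounded_distance (f g : G -> G -> R) : Prop :=
  exists C : R, forall x y, `|f x y - g x y| <= C.

(* The class of any element of metricsD at bounded distance from
   t dstar + theta(t) d; two such elements are roughly similar. *)
Definition manhattan_curve dstar d (t : R) : set (G -> G -> R) :=
  rough_class metricsD
    (xget (fun _ _ => 0)
      [set dt | metricsD dt /\
        bounded_distance dt
          (fun x y => t * dstar x y + manhattan_theta dstar d t * d x y)]).

(* Delta is additive along the Manhattan curve, so Delta is the arc length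
   between two points of the curve and parametrization by arc length means
   Delta (sigma s) (sigma t) = |s - t|. *)
Definition is_manhattan_geodesic rhostar rho
    (sigma : R -> set (G -> G -> R)) : Prop :=
  exists dstar d, [/\ rhostar dstar, rho d &
    exists phi : R -> R,
      [/\ set_bij setT setT phi, {homo phi : s t / s < t} &
          forall s, sigma s = manhattan_curve dstar d (phi s)]] /\
    [/\ forall s t, Delta (sigma s) (sigma t) = `|s - t|,
        sigma 0 = rho & sigma (Delta rho rhostar) = rhostar].

(* The unique such parametrization, for distinct elements of scrD. *)
Definition manhattan_geodesic rhostar rho : R -> set (G -> G -> R) :=
  xget (fun=> set0) [set sigma | is_manhattan_geodesic rhostar rho sigma].

(* The unique class in boundary_scrD whose representatives are all roughly
   similar to Dil(d,dstar) dstar - d. *)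
Definition manhattan_limit rhostar rho : set (G -> G -> R) :=
  xget set0 [set rho' | boundary_scrD rho' /\
    exists dstar d, [/\ rhostar dstar, rho d &
      forall d', rho' d' ->
        roughly_similar d' (fun x y => dil d dstar * dstar x y - d x y)]].

End ManhattanGeodesics.

Definition hyperbolic_group (R : realType) (G : groupType) : Prop :=
  exists2 S : set G, finite_symmetric_generating S &
    is_hyperbolic (@word_metric R G S).

(* Main.v *)
Require Import Defs.
From mathcomp Require Import all_boot all_order all_algebra.
From mathcomp Require Import all_classical all_reals all_analysis.
From mathcomp Require Import lra zify.

Set Implicit Arguments.
Unset Strict Implicit.
Unset Printing Implicit Defensive.

Import Order.TTheory GRing.Theory Num.Theory.
Import numFieldNormedType.Exports.

Local Open Scope classical_set_scope.
Local Open Scope ring_scope.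

(** Write W for the word metric of a finite symmetric generating set, [d] for a
representative of [rho] and [e] for a representative of [rho_inf]. The class
[rho_star] is that of the sum [d + e]. The Gromov products of [d] and of [e]
are both dominated by those of W, and this alone makes a left-invariant pseudo
metric hyperbolic; so [d + e], which is bounded below by [d], belongs to D.
For the translation lengths, written l, every factor c with
[l_d <= c * l_(d + e)] is at least 1: otherwise
[l_e >= (1 / c - 1) * l_d], and [e] would be quasi-isometric to [d], which is
excluded on the boundary. Hence [Dil(d, d + e) = 1], and the limit at infinity
of the geodesic from [d] to [d + e] is [Dil(d, d + e) (d + e) - d = e]. For the
same reason [d + e] is not roughly similar to [d].
Conversely, if [rho_inf] is the limit of the geodesic from [rho] to a class
[rho'], then up to scaling a representative of [rho'] is at bounded distance
from [d + tau e] with [tau > 0], a combination of [d + e] and [d] in which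
[d + e] has a positive coefficient; it remains to see that the Manhattan
geodesic meets the ray of every such combination, at a positive time.

Four facts support this. (1) [metricsD_dominated]: by stability of
quasi-geodesics, W-geodesics are rough geodesics for every hyperbolic pseudo
metric quasi-isometric to W, so that its Gromov products are dominated by those
of W. Dominated functions form a vector space, which is where all the linear
combinations live. (2) [spectrum_determines]: up to a bounded error, every
element can be multiplied by an element of a fixed finite set so that
displacement becomes translation length, for all dominated pseudo metrics at
once. So linear inequalities between translation lengths and between metrics
are equivalent up to additive constants. (3) [degenerate_divergence]: if a
dominated function bounded below takes bounded values at arbitrarily long
elements, a free subsemigroup makes the exponential sum diverge even after a
small multiple of a metric is added to it. (4) [connectors]: in a
non-elementary hyperbolic group finitely many elements suffice to leave any
given directions transversally; (2) and (3) rest on this.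

For two metrics [ds] and [d] in D, facts (2) and (3) identify the combinations
[t ds + s d] that are close to an element of D with an open cone, show that the
graph of [theta] stays inside this cone and that it meets each of its rays
exactly once. On combinations in the cone, Delta is the Hilbert metric of the
cone, that is the distance between the values of one explicit coordinate
([hilbert_coord]). This coordinate increases from minus infinity to infinity
along the graph of [theta], and its inverse is the arc-length
parametrization. *)

(** * The four-point condition *)

Section FourPoint.
Context {R : realType} {G : groupType}.
Implicit Types (d : G -> G -> R) (delta : R).

(** For symmetric [d] this is hyperbolicity, written without a base point and
without minima: among the three sums of opposite distances the two largest are
almost equal. *)
Definition four_point d delta : Prop := forall x y z w,
  d x y + d z w <= d x z + d y w + 2 * delta \/
  d x y + d z w <= d x w + d y z + 2 * delta.

Lemma hyperbolic_four_point d : (forall x y, d x y = d y x) ->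
  is_hyperbolic d -> exists2 delta : R, 0 <= delta & four_point d delta.
Proof.
move=> dC [delta delta0 hd]; exists delta => // x y z w.
have := hd x y z w; rewrite lerBlDr ge_min /gromov_product.
rewrite (dC y w) (dC x w) (dC w z) (dC z y) (dC w y).
by move=> /orP[] ?; [right|left]; lra.
Qed.

Lemma four_point_product d delta : (forall x y, d x y = d y x) ->
  four_point d delta -> forall z x y w,
  gromov_product d z x w <= gromov_product d z x y + delta \/
  gromov_product d z w y <= gromov_product d z x y + delta.
Proof.
move=> dC hd z x y w; rewrite /gromov_product.
have := hd x y z w; rewrite (dC y w) (dC x w) (dC w z) (dC z y) (dC w y).
by move=> [] ?; [right|left]; lra.
Qed.

Lemma pseudo_metric_sym d : is_pseudo_metric d -> forall x y, d x y = d y x.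
Proof. by case. Qed.

End FourPoint.

(** * Stability of quasi-geodesics *)

Section Morse.
Context {R : realType} {G : groupType}.
Implicit Types (d : G -> G -> R) (delta L c A : R).

(** The function [f] plays the distance to a base point, which need not be
realized by a point. Halving the path N times costs [delta] each time, so a
path of length [2 ^ N] loses only [N * delta]: this logarithmic loss is the
engine of the stability of quasi-geodesics. *)
Lemma dyadic_chain d (f : G -> R) delta (B : R) (p : nat -> G) N j k :
  0 <= delta ->
  (forall u v w, d u v + f w <= d u w + f v + 2 * delta \/
                 d u v + f w <= d w v + f u + 2 * delta) ->
  (j < k)%N -> (k - j <= 2 ^ N)%N ->
  (forall i, (j <= i < k)%N -> B <= f (p i) + f (p i.+1) - d (p i) (p i.+1)) ->
  B - 2 * N%:R * delta <= f (p j) + f (p k) - d (p j) (p k).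
Proof.
move=> delta0 hf; elim: N j k => [|N IH] j k ltjk lek hB.
  have -> : k = j.+1 by move: lek; rewrite expn0; lia.
  have := hB j; rewrite leqnn ltjk => /(_ isT); lra.
have N0 : 0 <= N%:R * delta :> R by apply: mulr_ge0.
have [lekN|ltNk] := leqP (k - j) (2 ^ N).
  have := IH _ _ ltjk lekN hB; rewrite -natr1; lra.
have p0 : (0 < 2 ^ N)%N by rewrite expn_gt0.
have h1 := IH j (j + 2 ^ N)%N; have h2 := IH (j + 2 ^ N)%N k.
have {}h1 : B - 2 * N%:R * delta
    <= f (p j) + f (p (j + 2 ^ N)%N) - d (p j) (p (j + 2 ^ N)%N).
  by apply: h1; try lia; move=> i ratio_sup; apply: hB; lia.
have {}h2 : B - 2 * N%:R * delta
    <= f (p (j + 2 ^ N)%N) + f (p k) - d (p (j + 2 ^ N)%N) (p k).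
  apply: h2; [by lia|by move: lek; rewrite expnS; lia|].
  by move=> i ratio_sup; apply: hB; lia.
have := hf (p j) (p k) (p (j + 2 ^ N)%N).
by rewrite -natr1; move=> [] ?; lra.
Qed.

Lemma leq_mul_exp2 (a : nat) : exists N0, forall N, (N0 <= N)%N ->
  (a * N.+1 <= 2 ^ N)%N.
Proof.
exists (2 * a + 4)%N => N leN.
have e n : (n < 2 ^ n)%N by exact: ltn_expl.
have -> : (2 ^ N = 2 ^ N./2 * 2 ^ (N - N./2))%N.
  by rewrite -expnD; congr (2 ^ _)%N; lia.
apply: leq_trans (_ : (2 ^ a * (2 * 2 ^ N./2) <= _)%N).
  apply: leq_mul; first exact: ltnW (e a).
  have := e N./2; lia.
by rewrite -expnS -!expnD leq_exp2l //; lia.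
Qed.

Lemma linear_beats_log (a b c delta : R) : 0 <= a -> 0 <= b -> 0 <= delta ->
  exists D0 : nat, forall D : nat, (D0 <= D)%N -> exists N : nat,
    a * D%:R + b <= (2 ^ N)%:R /\ N%:R * delta + c < D%:R.
Proof.
move=> a0 b0 delta0.
have nat_above (x : R) : exists n : nat, x <= n%:R.
  by exists (Num.truncn x).+1; exact/ltW/truncnS_gt.
have [q hq] := nat_above (2 * delta + 1).
have q0 : (0 < q)%N.
  by rewrite -(ltr_nat R); apply: lt_le_trans hq; lra.
have [a' ha'] := nat_above (a * q%:R + b).
have [N0 hN0] := leq_mul_exp2 a'.
have [m hm] := nat_above (2 * c).
exists (maxn (q * N0) m.+1) => D; rewrite geq_max => /andP[qD mD].
exists (D %/ q)%N; split.
  have D1 : D%:R <= q%:R * (D %/ q).+1%:R :> R.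
    rewrite -natrM ler_nat mulnC; apply: ltnW; exact: ltn_ceil.
  have k1 : 1 <= (D %/ q).+1%:R :> R by rewrite ler1n.
  apply: le_trans (_ : a' %:R * (D %/ q).+1%:R <= _).
    apply: le_trans (_ : (a * q%:R + b) * (D %/ q).+1%:R <= _); last first.
      exact: ler_wpM2r.
    rewrite mulrDl -mulrA; apply: lerD; first exact: ler_wpM2l.
    by rewrite ler_peMr.
  rewrite -natrM ler_nat; apply: hN0.
  by rewrite leq_divRL // mulnC.
have D2 : (D %/ q)%:R * (2 * delta + 1) <= D%:R :> R.
  apply: le_trans (_ : (D %/ q)%:R * q%:R <= _); first exact: ler_wpM2l.
  by rewrite -natrM ler_nat leq_divM.
have m1 : m%:R < D%:R :> R by rewrite ltr_nat.
have : 0 <= (D %/ q)%:R :> R by [].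
move: D2; rewrite mulrDr mulr1 mulrCA; lra.
Qed.

(** A four-point space need not contain points between [x] and [y]. The function
[virtual_dist t] is the distance to a fictitious point at distance [t] from [x]
on a segment from [x] to [y]. Being a maximum of two distance functions shifted
by constants, it inherits the four-point condition, so such points can be used
as if they existed. *)

Section VirtualPoints.
Variables (d : G -> G -> R) (delta : R) (x y : G).
Hypotheses (dP : is_pseudo_metric d) (dH : four_point d delta).

Definition virtual_dist (t : R) (u : G) : R :=
  Num.max (d u x - t) (d u y - (d x y - t)).

Local Notation f := virtual_dist.

Lemma virtual_dist_geL t u : d u x - t <= f t u.
Proof. by rewrite le_max lexx. Qed.

Lemma virtual_dist_geR t u : d u y - (d x y - t) <= f t u.
Proof. by rewrite le_max lexx orbT. Qed.

Lemma virtual_dist_four_point t u v w :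
  d u v + f t w <= d u w + f t v + 2 * delta \/
  d u v + f t w <= d w v + f t u + 2 * delta.
Proof.
have dC := pseudo_metric_sym dP.
have h1 := virtual_dist_geL t; have h2 := virtual_dist_geR t.
rewrite {1 3}/f /Num.max; case: ifP => _.
  have := dH u v w y; have := h2 u; have := h2 v; rewrite (dC w v).
  by move=> ? ? [] ?; [left|right]; lra.
have := dH u v w x; have := h1 u; have := h1 v; rewrite (dC w v).
by move=> ? ? [] ?; [left|right]; lra.
Qed.

Lemma dist_le_virtual s t u v :
  d u v <= f s u + f t v + `|s - t| + 2 * delta.
Proof.
have h1 := virtual_dist_geL; have h2 := virtual_dist_geR.
have := h1 s u; have := h2 s u; have := h1 t v; have := h2 t v.
have := ler_norm (s - t); have := ler_norm (t - s); rewrite (distrC t s).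
by have := dH u v x y; move=> [] *; lra.
Qed.

(** A path that passes from one side of the fictitious point to the other has
endpoints with small Gromov product there. *)
Lemma virtual_product_far t r u v :
  0 <= r -> delta < 2 * r -> d u x <= t - r -> d v y <= d x y - t - r ->
  f t u + f t v - d u v <= 2 * delta.
Proof.
case: dP => d0 dd dC dT r0 hr hu hv.
have hxy : 0 <= d u x by [].
have hxy' : 0 <= d v y by [].
have := dT x u y; have := dT x v y; rewrite (dC x u) (dC x v) => tv tu.
have -> : f t u = d u y - (d x y - t).
  by apply: max_r; move: (d0 x y); lra.
have -> : f t v = d v x - t.
  by apply: max_l; lra.
have := dH u y x v; rewrite (dC y v) (dC y x) (dC x v).
by move=> [] ?; lra.
Qed.

End VirtualPoints.

Lemma path_dist d (p : nat -> G) n A : is_pseudo_metric d ->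
  (forall i, (i < n)%N -> d (p i) (p i.+1) <= A) ->
  forall j k, (j <= k <= n)%N -> d (p j) (p k) <= A * (k - j)%:R.
Proof.
move=> [d0 dd dC dT] hA j k /andP[jk kn]; elim: k jk kn => [|k IH] jk kn.
  have -> : j = 0%N by lia.
  by rewrite dd subnn mulr0.
have [->|jk'] := eqVneq j k.+1; first by rewrite dd subnn mulr0.
have jk1 : (j <= k)%N by lia.
have := IH jk1 (ltnW kn); have := hA _ kn; have := dT (p j) (p k) (p k.+1).
by rewrite subSn // -natr1; lra.
Qed.

(** Stability of quasi-geodesics in a hyperbolic space that may have no geodesics.
Let D be the least number such that every fictitious point between the ends of
the path is within D of the path. Near a point that almost realizes D, the path
must make a detour of length linear in D while staying at distance D, and by
[dyadic_chain] this is impossible once D exceeds the logarithm of the detour.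
Conversely, as the fictitious point slides from one end to the other, it is at
some moment close both to the part of the path before [p i] and to the part
after it; these two parts being close at that place, so is [p i]. *)
Lemma quasigeodesic_product_bounded L c A delta :
  0 <= L -> 0 <= c -> 0 <= A -> 0 <= delta ->
  exists2 C : R, 0 <= C & forall d, is_pseudo_metric d -> four_point d delta ->
  forall (p : nat -> G) (n : nat),
  (forall i, (i < n)%N -> d (p i) (p i.+1) <= A) ->
  (forall j k, (j <= k <= n)%N -> (k - j)%:R <= L * d (p j) (p k) + c) ->
  forall i, (i <= n)%N -> gromov_product d (p i) (p 0%N) (p n) <= C.
Proof.
move=> L0 c0 A0 delta0.
(* The detour joins points near the fictitious points at distance 2 D on both
   sides: its ends are at distance at most D + 4 D + D, up to constants. *)
have [//||D0 hD0] := @linear_beats_log (6 * L) (2 * L * delta + c)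
    (2 + A + delta) delta _ _ delta0.
- by apply: mulr_ge0.
- by apply: addr_ge0 => //; apply: mulr_ge0 => //; apply: mulr_ge0.
pose Lam := L * (2 * D0%:R + 1 + 2 * delta) + c.
have Lam0 : 0 <= Lam.
  apply: addr_ge0 => //; apply: mulr_ge0 => //.
  by have : 0 <= D0%:R :> R by []; lra.
exists (D0%:R + A * Lam).
  by apply: addr_ge0 => //; apply: mulr_ge0.
move=> d dP dH p n hA hL i lein.
have [d0 dd dC dT] := dP.
set x := p 0%N; set y := p n; pose T := d x y.
pose f := virtual_dist d x y.
have T0 : 0 <= T by exact: d0.
pose P (D : nat) := forall t : R, 0 <= t <= T -> exists2 j, (j <= n)%N & f t (p j) <= D%:R.
have exP : exists D, `[< P D >].
  exists (Num.truncn T).+1; apply/asboolP => t /andP[t0 tT]; exists 0%N => //.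
  apply/ltW; apply: le_lt_trans (truncnS_gt _).
  by rewrite /f /virtual_dist dd ge_max -/x -/T; apply/andP; split; lra.
case: (ex_minnP exP) => D /asboolP PD minD.
have leD : (D <= D0)%N.
  rewrite leqNgt; apply/negP => ltD.
  have [N [hN1 hN2]] := hD0 _ (ltnW ltD).
  have D1 : (0 < D)%N by lia.
  have : ~ P D.-1 by move=> /asboolP /minD; lia.
  move=> /existsNP[t] /not_implyP[tT] ht.
  have {}ht j : (j <= n)%N -> D%:R - 1 < f t (p j).
    move=> jn; rewrite ltNge; apply/negP => hj; apply: ht; exists j => //.
    by move: hj; rewrite -[in X in X%:R - 1](prednK D1) -natr1; lra.
  move: tT => /andP[t0 tT].
  have DR : delta + 2 + A < D%:R.
    have : 0 <= N%:R * delta :> R by apply: mulr_ge0.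
    by lra.
  (* When t is within 2 D of an end of the segment, that end itself replaces
     the point of the path near the fictitious point at distance 2 D. *)
  have [s [j [jn sj fj xj st]]] : exists (s : R) j, [/\ (j <= n)%N, t - 2 * D%:R <= s,
      f s (p j) <= D%:R, d (p j) x <= t - (D%:R - 1) & s <= t].
    have [h|h] := leP (2 * D%:R) t.
      have [|j jn fj] := PD (t - 2 * D%:R); first by apply/andP; split; lra.
      exists (t - 2 * D%:R), j; split => //; last by lra.
      by have := virtual_dist_geL d x y (t - 2 * D%:R) (p j); rewrite -/f; lra.
    exists 0, 0%N; split => //; [by lra| |].
      by rewrite /f /virtual_dist -/x dd subr0 subr0 subrr maxxx.
    have := ht 0%N isT; rewrite /f /virtual_dist -/x dd -/T.
    by rewrite lt_max => /orP[]; lra.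
  have [s' [k [kn sk fk yk st']]] : exists (s : R) k, [/\ (k <= n)%N, s <= t + 2 * D%:R,
      f s (p k) <= D%:R, d (p k) y <= T - t - (D%:R - 1) & t <= s].
    have [h|h] := leP (t + 2 * D%:R) T.
      have [|k kn fk] := PD (t + 2 * D%:R); first by apply/andP; split; lra.
      exists (t + 2 * D%:R), k; split => //; last by lra.
      have := virtual_dist_geR d x y (t + 2 * D%:R) (p k).
      by rewrite -/f -/T; lra.
    exists T, n; split => //; [by lra| |].
      by rewrite /f /virtual_dist -/y dd dC -/T subrr subrr maxxx.
    have := ht n (leqnn _); rewrite /f /virtual_dist -/y dd dC -/T.
    by rewrite lt_max => /orP[]; lra.
  have far : f t (p j) + f t (p k) - d (p j) (p k) <= 2 * delta.
    by apply: (@virtual_product_far d delta x y dP dH t (D%:R - 1)) => //; lra.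
  have djk : d (p j) (p k) <= 6 * D%:R + 2 * delta.
    have := dist_le_virtual x y dH s s' (p j) (p k).
    by rewrite -/f distrC ger0_norm; lra.
  have len a b : (a <= b <= n)%N -> d (p a) (p b) <= 6 * D%:R + 2 * delta ->
      (b - a <= 2 ^ N)%N.
    move=> ab hab; rewrite -(ler_nat R); apply: le_trans hN1.
    apply: le_trans (hL _ _ ab) _.
    by have := ler_wpM2l L0 hab; lra.
  have chain a b : (a < b <= n)%N -> d (p a) (p b) <= 6 * D%:R + 2 * delta ->
      2 * (D%:R - 1) - A - 2 * N%:R * delta
      <= f t (p a) + f t (p b) - d (p a) (p b).
    move=> /andP[ab bn] hab.
    apply: (@dyadic_chain d (f t) delta _ p N a b delta0 _ ab).
    - by move=> u v w; exact: virtual_dist_four_point.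
    - by apply: len hab; rewrite (ltnW ab) bn.
    - move=> l /andP[al lb].
      have ln : (l < n)%N := leq_trans lb bn.
      by have := ht _ (ltnW ln); have := ht _ ln; have := hA _ ln; lra.
  have {chain} : 2 * (D%:R - 1) - A - 2 * N%:R * delta <= 2 * delta.
    case: (ltngtP j k) => jk.
    - by by apply: le_trans far; apply: chain => //; rewrite jk kn.
    - apply: le_trans far; rewrite addrC (addrC (f t (p j))) dC addrC.
      by apply: chain; rewrite ?jk ?jn // dC.
    - move: far; rewrite jk dd; have := ht _ kn.
      have : 0 <= N%:R * delta :> R by apply: mulr_ge0.
      by lra.
  have : 0 <= N%:R * delta :> R by apply: mulr_ge0.
  by lra.
have {exP minD} {}PD : P D0.
  move=> t /PD[j jn fj]; exists j => //; apply: le_trans fj _.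
  by rewrite ler_nat.
have [t [t' [j [k [jik fj fk tt']]]]] : exists (t t' : R) j k,
    [/\ (j <= i <= k)%N && (k <= n)%N, f t (p j) <= D0%:R, f t' (p k) <= D0%:R & `|t - t'| <= 1].
  pose tt (m : nat) := Num.min m%:R T.
  have ttT m : 0 <= tt m <= T.
    by rewrite /tt le_min ler0n T0 ge_min lexx orbT.
  pose left m := `[< exists2 j, (j <= i)%N & f (tt m) (p j) <= D0%:R >].
  have left0 : left 0%N.
    apply/asboolP; exists 0%N => //.
    have -> : tt 0%N = 0 by rewrite /tt min_l.
    by rewrite /f /virtual_dist -/x dd subr0 subr0 subrr maxxx.
  have [lK|nlK] := boolP (left (Num.truncn T).+1).
    move: lK => /asboolP[j ji fj]; exists T, T, j, n; split.
    - by rewrite ji lein leqnn.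
    - by move: fj; rewrite /tt min_r //; exact/ltW/truncnS_gt.
    - by rewrite /f /virtual_dist -/y dd dC -/T subrr subrr maxxx.
    - by rewrite subrr normr0.
  have [m lm nlm] : exists2 m, left m & ~~ left m.+1.
    elim: (Num.truncn T).+1 nlK => [|K IH] nlK; first by rewrite left0 in nlK.
    by have [lK|/IH//] := boolP (left K); exists K.
  move: lm => /asboolP[j ji fj]; have [k kn fk] := PD _ (ttT m.+1).
  exists (tt m), (tt m.+1), j, k; split => //.
    rewrite ji kn andbT /= leqNgt; apply/negP => /ltnW ki.
    by case/negP: nlm; apply/asboolP; exists k.
  have h : m.+1%:R = m%:R + 1 :> R by rewrite natr1.
  by rewrite /tt; case: (leP _ T) => ?; case: (leP _ T) => ?;
    rewrite ler_norml; apply/andP; split; lra.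
have /andP[/andP[ji ik] kn] := jik.
have djk : d (p j) (p k) <= 2 * D0%:R + 1 + 2 * delta.
  by have := dist_le_virtual x y dH t t' (p j) (p k); rewrite -/f; lra.
have kj : (k - j)%:R <= Lam.
  apply: le_trans (hL j k _) _; first by rewrite (leq_trans ji ik) kn.
  by rewrite lerD2r; apply: ler_wpM2l.
have dji : d (p j) (p i) <= A * Lam.
  apply: le_trans (path_dist dP hA _) _; first by rewrite ji lein.
  apply: ler_wpM2l => //; apply: le_trans kj.
  by rewrite ler_nat leq_sub2r.
have := virtual_dist_geL d x y t (p j); have := virtual_dist_geR d x y t (p j).
rewrite -/f -/T /gromov_product -/x -/y -/T.
have := dT x (p j) (p i); have := dT (p i) (p j) y.
by rewrite (dC (p i) (p j)) (dC x (p j)); lra.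
Qed.

End Morse.

(** * Word length *)

Section WordLength.
Context {G : groupType}.

(** The properties of word lengths used below: [len y + len (y^-1 * x) = len x] can
be solved for every intermediate value, which provides geodesics, and spheres
grow at most exponentially. *)
Definition is_word_length (len : G -> nat) : Prop :=
  [/\ forall x, (len x = 0%N) <-> x = 1%g,
      forall x y, (len (x * y)%g <= len x + len y)%N,
      forall x, len x^-1%g = len x,
      forall x i, (i <= len x)%N -> exists2 y, len y = i & len (y^-1 * x)%g = (len x - i)%N
    & exists K : nat, forall n, exists2 l : seq G, (size l <= K ^ n)%N &
        forall x, len x = n -> x \in l].

Definition word_dist {R : realType} (len : G -> nat) (x y : G) : R :=
  (len (x^-1 * y)%g)%:R.

Lemma prodg_rev_inv (w : seq G) :
  (\prod_(s <- rev [seq s^-1 | s <- w]) s = (\prod_(s <- w) s)^-1)%g.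
Proof.
elim: w => [|a w IH] /=; first by rewrite !big_nil invg1.
by rewrite rev_cons -cats1 big_cat /= big_seq1 IH big_cons invgM.
Qed.

Lemma word_length_exists (S : set G) : finite_symmetric_generating S ->
  exists2 len, is_word_length len &
    [/\ forall x, S x -> (len x <= 1)%N
      & forall (R : realType) (x y : G), word_metric S x y = word_dist len x y :> R].
Proof.
move=> [finS Sinv Sgen].
have exlen x : exists n, `[< exists2 w, words S x w & size w = n >].
  by have [w hw] := Sgen x; exists (size w); apply/asboolP; exists w.
pose len x := ex_minn (exlen x).
have lenP x : exists2 w, words S x w & size w = len x.
  by rewrite /len; case: ex_minnP => n /asboolP.
have len_min x w : words S x w -> (len x <= size w)%N.
  move=> hw; rewrite /len; case: ex_minnP => n _ hn; apply: hn.
  by apply/asboolP; exists w.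
have wcat x y w v : words S x w -> words S y v -> words S (x * y)%g (w ++ v).
  move=> [h1 h2] [h3 h4]; split; last by rewrite big_cat /= h2 h4.
  by move=> s; rewrite mem_cat => /orP[/h1|/h3].
have wsub w v : (forall s, s \in w ++ v -> S s) ->
    (forall s, s \in w -> S s) /\ (forall s, s \in v -> S s).
  by move=> h; split=> s sw; apply: h; rewrite mem_cat sw ?orbT.
have lenM x y : (len (x * y)%g <= len x + len y)%N.
  have [w hw <-] := lenP x; have [v hv <-] := lenP y.
  by rewrite -size_cat; apply: len_min; exact: wcat.
have len1 : len 1%g = 0%N.
  have h := @len_min 1%g [::]; apply/eqP; rewrite -leqn0; apply: h.
  by split => //; rewrite big_nil.
have lenV' x : (len x^-1%g <= len x)%N.
  have [w [h1 h2] <-] := lenP x.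
  have -> : size w = size (rev [seq (s^-1)%g | s <- w]) by rewrite size_rev size_map.
  apply: len_min; split; last by rewrite prodg_rev_inv h2.
  by move=> s; rewrite mem_rev => /mapP[t /h1 ht ->]; exact: Sinv.
exists len; split.
- move=> x; split => [x0|->//]; have [w [h1 h2]] := lenP x.
  by rewrite x0 => /size0nil w0; rewrite -h2 w0 big_nil.
- exact: lenM.
- move=> x; apply/eqP; rewrite eqn_leq lenV' /=.
  by have := lenV' (x^-1)%g; rewrite invgK.
- move=> x i ix; have [w [h1 h2] sw] := lenP x.
  pose y := (\prod_(s <- take i w) s)%g.
  have [w1 w2] : (forall s, s \in take i w -> S s) /\ (forall s, s \in drop i w -> S s).
    by apply: wsub; rewrite cat_take_drop.
  have ly : (len y <= i)%N.
    have : words S y (take i w) by split.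
    by move=> /len_min; rewrite size_take sw; case: ltnP => //; lia.
  have xE : (y^-1 * x = \prod_(s <- drop i w) s)%g.
    by rewrite -h2 -{1}(cat_take_drop i w) big_cat /= mulgA mulVg mul1g.
  have lz : (len (y^-1 * x)%g <= len x - i)%N.
    have : words S (y^-1 * x)%g (drop i w) by split.
    by move=> /len_min; rewrite size_drop sw.
  have := lenM y (y^-1 * x)%g; rewrite mulgA mulgV mul1g => h.
  by exists y; lia.
- have /finite_seqP[s sS] := finS.
  have {sS}sS x : S x -> x \in s by rewrite sS.
  exists (size s); elim=> [|n [l sl hl]].
    exists [:: 1%g] => // x; have [w [_ <-] sw] := lenP x.
    by move=> lx; move: sw; rewrite lx => /size0nil ->; rewrite big_nil inE.
  exists [seq (a * b)%g | a <- s, b <- l].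
    by rewrite size_allpairs expnS leq_mul2l sl orbT.
  move=> x; have [[|a w] [h1 h2] sw] := lenP x => lx; first by rewrite -sw in lx.
  apply/allpairsP; exists (a, \prod_(i <- w) i)%g => /=; split.
  - by apply/sS/h1; rewrite mem_head.
  - apply: hl; have aw : words S (\prod_(i <- w) i)%g w.
      by split => // t tw; apply: h1; rewrite in_cons tw orbT.
    have l1 := len_min _ _ aw.
    have : (len x <= 1 + len (\prod_(i <- w) i)%g)%N.
      rewrite -h2 big_cons; apply: leq_trans (lenM _ _) _; rewrite leq_add2r.
      have : words S a [:: a].
        by split=> [t|]; rewrite ?inE ?big_seq1 // => /eqP->; apply: h1; rewrite mem_head.
      by move/len_min.
    by move: sw l1; rewrite lx /=; lia.
  - by rewrite -h2 big_cons.
- move=> x Sx; have : words S x [:: x].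
    by split=> [t|]; rewrite ?inE ?big_seq1 // => /eqP->.
  by move/len_min.
- move=> R x y; rewrite /word_metric /word_dist; set X := [set _ | _ in _].
  have [w hw sw] := lenP (x^-1 * y)%g.
  have Xw : X (len (x^-1 * y)%g)%:R by exists w => //; rewrite sw.
  have lbX : lbound X (len (x^-1 * y)%g)%:R.
    by move=> _ [v hv <-]; rewrite ler_nat; exact: len_min.
  apply/eqP; rewrite eq_le; apply/andP; split.
    by apply: ge_inf => //; exists (len (x^-1 * y)%g)%:R.
  by apply: lb_le_inf => //; exists (len (x^-1 * y)%g)%:R.
Qed.

Section LengthFacts.
Context {R : realType} (len : G -> nat) (hlen : is_word_length len).

Local Notation W := (@word_dist R len).

Lemma len1 : len 1%g = 0%N.
Proof. by case: hlen => h *; apply/h. Qed.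

Lemma lenM x y : (len (x * y)%g <= len x + len y)%N.
Proof. by case: hlen. Qed.

Lemma lenV x : len x^-1%g = len x.
Proof. by case: hlen. Qed.

Lemma len_split x i : (i <= len x)%N ->
  exists2 y, len y = i & len (y^-1 * x)%g = (len x - i)%N.
Proof. by case: hlen => _ _ _ h _; exact: h. Qed.

Lemma len_ball_finite r : exists l : seq G, forall x, (len x <= r)%N -> x \in l.
Proof.
case: hlen => _ _ _ _ [K hK].
elim: r => [|r [l hl]].
  by have [l _ hl] := hK 0%N; exists l => x; rewrite leqn0 => /eqP/hl.
have [l' _ hl'] := hK r.+1; exists (l ++ l') => x; rewrite mem_cat.
by rewrite leq_eqVlt ltnS => /orP[/eqP/hl'->|/hl->//]; rewrite orbT.
Qed.

Lemma word_dist_pseudo_metric : is_pseudo_metric W.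
Proof.
split => [x y|x|x y|x y z]; rewrite /word_dist.
- exact: ler0n.
- by rewrite mulVg len1.
- by rewrite -lenV invgM invgK.
- rewrite -natrD ler_nat; apply: leq_trans (lenM _ _).
  by rewrite mulgA mulgK.
Qed.

Lemma word_dist_left_invariant : left_invariant W.
Proof. by move=> z x y; rewrite /word_dist invgM mulgA mulgVK. Qed.

Lemma word_dist1 x : W 1%g x = (len x)%:R.
Proof. by rewrite /word_dist invg1 mul1g. Qed.

Lemma word_geodesic_point x y i : (i <= len (x^-1 * y)%g)%N ->
  exists z, W x z = i%:R /\ W z y = (len (x^-1 * y)%g - i)%:R.
Proof.
move=> /len_split[z h1 h2]; exists (x * z)%g; rewrite /word_dist mulgA mulVg mul1g.
by rewrite h1 invgM -mulgA h2.
Qed.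

Lemma word_geodesic x y : exists p : nat -> G,
  [/\ p 0%N = x, p (len (x^-1 * y)%g) = y &
   forall j k, (j <= k <= len (x^-1 * y)%g)%N -> W (p j) (p k) = (k - j)%:R].
Proof.
have len0 z : len z = 0%N -> z = 1%g by case: hlen => h _ _ _ _ /h.
move: {2}(len _) (erefl (len (x^-1 * y)%g)) => n; elim: n y => [|n IH] y ly.
  rewrite ly; have := len0 _ ly => /eqP; rewrite mulg_eq1 eq_sym => /eqP.
  move=> /invg_inj yx; exists (fun=> x); split => // j k.
  by rewrite leqn0 => /andP[jk /eqP k0]; rewrite /word_dist mulVg len1 k0 sub0n.
rewrite ly; have [z [h1 h2]] : exists z, W x z = n%:R /\ W z y = 1.
  have [|z [h1 h2]] := @word_geodesic_point x y n; first by rewrite ly.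
  by exists z; rewrite h2 ly subSnn.
have lz : len (x^-1 * z)%g = n.
  by apply/eqP; rewrite -(eqr_nat R); apply/eqP.
have [p [p0 pn hp]] := IH _ lz; rewrite lz in pn hp.
exists (fun i => if (i <= n)%N then p i else y); split; rewrite ?ltnn //.
move=> j k /andP[jk kn]; have [jn|nj] := leqP j n; last first.
  have -> : k = j by lia.
  have -> : (j <= n)%N = false by lia.
  by case: word_dist_pseudo_metric => _ -> _ _; rewrite subnn.
have [k'|nk] := leqP k n; first by rewrite hp // jk k'.
have -> : k = n.+1 by lia.
have [_ _ WC WT] := word_dist_pseudo_metric.
have h3 := WT x (p j) y; have h4 := WT (p j) z y.
have h5 : W x y = n.+1%:R by rewrite /word_dist ly.
have := hp 0%N j; rewrite p0 jn subn0 => /(_ isT) h6.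
have := hp j n; rewrite pn leqnn jn => /(_ isT) h7.
apply/eqP; rewrite eq_le subSn // -natr1; apply/andP; split; first by lra.
by rewrite natrB // in h7 *; move: h5; rewrite -natr1; lra.
Qed.

(** Bound the displacement of the finitely many elements of length at most 1, then
move along a geodesic. *)
Lemma len_lipschitz (d : G -> G -> R) : is_pseudo_metric d -> left_invariant d ->
  exists2 A : R, 0 <= A & forall x y, d x y <= A * W x y.
Proof.
move=> [d0 dd dC dT] dL.
have [l hl] := len_ball_finite 1.
exists (\sum_(s <- l) d 1%g s); first by apply: sumr_ge0.
set A := (\sum_(s <- l) d 1%g s).
have A1 s : s \in l -> d 1%g s <= A.
  move=> sl; rewrite /A (big_rem s) //= ler_wpDr //; exact: sumr_ge0.
have key n x : len x = n -> d 1%g x <= A * n%:R.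
  elim: n x => [|n IH] x lx.
    have -> : x = 1%g by case: hlen => h _ _ _ _; apply/h.
    by rewrite dd mulr0.
  have [|y ly lyx] := @len_split x n; first by rewrite lx.
  apply: le_trans (dT _ y _) _; rewrite -natr1 mulrDr mulr1.
  apply: lerD; first exact: IH.
  rewrite -(dL (y^-1)%g) mulVg; apply: A1; apply: hl.
  by rewrite lyx lx subSnn.
move=> x y; rewrite /word_dist -(dL (x^-1)%g) mulVg; exact: key.
Qed.

End LengthFacts.
End WordLength.

(** * Gromov products *)

Section Products.
Context {R : realType} {G : groupType}.
Implicit Types (d psi : G -> G -> R).

Lemma product_ge0 d z x y : is_pseudo_metric d -> 0 <= gromov_product d z x y.
Proof.
by move=> [_ _ dC dT]; rewrite /gromov_product; have := dT x z y; lra.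
Qed.

Lemma product_sym d z x y : (forall x y, d x y = d y x) ->
  gromov_product d z x y = gromov_product d z y x.
Proof. by move=> dC; rewrite /gromov_product (dC x y) (dC x z) (dC z y); lra. Qed.

Lemma product_invariant d g z x y : left_invariant d ->
  gromov_product d (g * z)%g (g * x)%g (g * y)%g = gromov_product d z x y.
Proof. by move=> dL; rewrite /gromov_product !dL. Qed.

(** When the three products at [c] are bounded, [c] is a centre of the triangle and
the product at [z] is the distance from [z] to [c] up to a constant. *)
Lemma product_rebase psi z x y c : (forall x y, psi x y = psi y x) ->
  gromov_product psi z x y = psi z c - gromov_product psi c x z
    - gromov_product psi c y z + gromov_product psi c x y.
Proof.
by move=> pC; rewrite /gromov_product (pC x z) (pC z y) (pC x c) (pC c z) (pC y c); lra.
Qed.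

Lemma product_add psi z x y : (forall x y, psi x y = psi y x) ->
  gromov_product psi z x y + gromov_product psi x z y = psi z x.
Proof. by move=> pC; rewrite /gromov_product (pC x z) (pC z y); lra. Qed.

Lemma product_le_dist d z x y : is_pseudo_metric d -> gromov_product d z x y <= d z x.
Proof.
move=> dP; rewrite -(@product_add d z x y (pseudo_metric_sym dP)).
by rewrite lerDl product_ge0.
Qed.

Lemma product_lipschitz d z x y y' : is_pseudo_metric d ->
  gromov_product d z x y <= gromov_product d z x y' + d y y'.
Proof.
move=> [_ _ dC dT]; rewrite /gromov_product (dC z y) (dC z y').
by have := dT y y' z; have := dT x y y'; lra.
Qed.

Lemma product_lipschitz_base d z z' x y : is_pseudo_metric d ->
  gromov_product d z x y <= gromov_product d z' x y + d z z'.
Proof.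
move=> [_ _ dC dT]; rewrite /gromov_product.
by have := dT x z' z; have := dT z z' y; rewrite (dC z' z); lra.
Qed.

(** A point [y] on a geodesic from [z] to [x] has smaller products than [x], with
no error term. *)
Lemma product_prefix d z x y a : is_pseudo_metric d -> d z y + d y x = d z x ->
  gromov_product d z y a <= gromov_product d z x a.
Proof.
move=> [_ _ dC dT] h; rewrite /gromov_product (dC y z) (dC x z).
by have := dT x y a; rewrite (dC x y); lra.
Qed.

End Products.

(** * Functions with dominated Gromov products *)

Section Dominated.
Context {R : realType} {G : groupType}.
Variables (len : G -> nat) (hlen : is_word_length len) (delta : R).
Local Notation W := (@word_dist G R len).
Hypotheses (delta0 : 0 <= delta) (WH : four_point W delta).
Implicit Types (d psi phi : G -> G -> R).

Let WP : is_pseudo_metric W := word_dist_pseudo_metric hlen.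
Let WC := pseudo_metric_sym WP.

(** The centre is the point of the geodesic at distance [(y|z)_x] from [x], rounded
down to an integer; the rounding costs the summand 1. *)
Lemma word_center x y z (p : nat -> G) :
  p 0%N = x -> p (len (x^-1 * y)%g) = y ->
  (forall j k, (j <= k <= len (x^-1 * y)%g)%N -> W (p j) (p k) = (k - j)%:R) ->
  exists2 i, (i <= len (x^-1 * y)%g)%N &
    gromov_product W (p i) x z <= delta + 1 /\
    gromov_product W (p i) y z <= delta + 1.
Proof.
set n := len _ => p0 pn hp.
have [_ Wd _ WT] := WP.
have xy : W x y = n%:R by rewrite -p0 -pn hp ?leqnn ?subn0.
have g0 : 0 <= gromov_product W x y z by exact: product_ge0.
have gn : gromov_product W x y z <= n%:R by rewrite -xy product_le_dist.
pose i := Num.truncn (gromov_product W x y z).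
have i1 : i%:R <= gromov_product W x y z by rewrite truncn_le.
have i2 : gromov_product W x y z < i%:R + 1 by rewrite natr1; exact: truncnS_gt.
have lein : (i <= n)%N by rewrite -(ler_nat R); exact: le_trans gn.
exists i => //.
have hx : W x (p i) = i%:R by rewrite -p0 hp ?subn0.
have hy : W (p i) y = n%:R - i%:R by rewrite -pn hp ?leqnn ?lein // natrB.
move: i1 i2; rewrite /gromov_product.
have := WH x y (p i) z; have := WT x (p i) z; have := WT y (p i) z.
rewrite hx (WC y (p i)) hy (WC y x) xy => ? ? hW ? ?.
by split; case: hW => ?; lra.
Qed.

Lemma word_center_exists x y z : exists c,
  [/\ gromov_product W c x y = 0, gromov_product W c x z <= delta + 1
    & gromov_product W c y z <= delta + 1].
Proof.
have [p [p0 pn hp]] := @word_geodesic G R len hlen x y.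
have [i lein [h1 h2]] := word_center z p0 pn hp.
exists (p i); split => //; rewrite /gromov_product -{1}p0 -{1}pn.
rewrite hp // hp ?lein ?leqnn // subn0 natrB //.
by rewrite /word_dist; lra.
Qed.

(** Vanishing of the product of W at [z] means that [z] lies on a geodesic, and then
[psi] is additive along it up to a constant. The condition is linear in [psi] and
allows negative values, so it applies to differences of metrics. *)
Definition dominated psi : Prop :=
  [/\ left_invariant psi, forall x y, psi x y = psi y x, forall x, psi x x = 0
    & exists2 lam : R, 0 <= lam & forall z x y,
      `|gromov_product psi z x y| <= lam * gromov_product W z x y + lam].

Lemma dominated_lin psi phi t s : dominated psi -> dominated phi ->
  dominated (fun x y => t * psi x y + s * phi x y).
Proof.
move=> [pL pC pd [l l0 hl]] [qL qC qd [m m0 hm]]; split.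
- by move=> z x y; rewrite pL qL.
- by move=> x y; rewrite pC qC.
- by move=> x; rewrite pd qd !mulr0 addr0.
exists (`|t| * l + `|s| * m); first by rewrite addr_ge0 // mulr_ge0.
move=> z x y.
have -> : gromov_product (fun x y => t * psi x y + s * phi x y) z x y =
    t * gromov_product psi z x y + s * gromov_product phi z x y.
  by rewrite /gromov_product !mulrA -mulrDl !mulrBr !mulrDr; lra.
have := hl z x y; have := hm z x y.
move: (gromov_product W _ _ _) (gromov_product psi _ _ _)
  (gromov_product phi _ _ _) => g a b hb ha.
apply: le_trans (ler_normD _ _) _; rewrite !normrM.
have := ler_wpM2l (normr_ge0 t) ha; have := ler_wpM2l (normr_ge0 s) hb.
by rewrite !mulrDr mulrDl !mulrA; lra.
Qed.

Lemma dominated_metric d lam : is_pseudo_metric d -> left_invariant d ->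
  (forall x y, gromov_product d 1%g x y <= lam * gromov_product W 1%g x y + lam) ->
  dominated d.
Proof.
move=> dP dL hd; have [d0 dd dC dT] := dP; split => //.
exists `|lam| => // z x y.
rewrite ger0_norm ?product_ge0 //.
have -> : gromov_product d z x y = gromov_product d 1%g (z^-1 * x)%g (z^-1 * y)%g.
  by rewrite -(product_invariant (z^-1)%g z) // mulVg.
have -> : gromov_product W z x y = gromov_product W 1%g (z^-1 * x)%g (z^-1 * y)%g.
  by rewrite -(product_invariant (z^-1)%g z) ?mulVg //; exact: word_dist_left_invariant.
apply: le_trans (hd _ _) _; apply: lerD; last exact: ler_norm.
by apply: ler_wpM2r; [exact: product_ge0|exact: ler_norm].
Qed.

Lemma dominated_bounded psi phi : dominated psi -> left_invariant phi ->
  (forall x y, phi x y = phi y x) -> (forall x, phi x x = 0) ->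
  bounded_distance phi psi -> dominated phi.
Proof.
move=> [pL pC pd [l l0 hl]] qL qC qd [C hC]; split => //.
have C0 : 0 <= C by exact: le_trans (hC 1%g 1%g).
exists (l + 2 * C); first by rewrite addr_ge0 // mulr_ge0.
move=> z x y; have := hl z x y; have := hC x z; have := hC z y; have := hC x y.
have := mulr_ge0 C0 (product_ge0 z x y WP).
rewrite mulrDl; move: (gromov_product W z x y) => g.
move: (l * g) => lg; rewrite -mulrA; move: (C * g) => Cg.
rewrite !ler_norml /gromov_product => ? /andP[? ?] /andP[? ?] /andP[? ?] /andP[? ?].
by apply/andP; split; lra.
Qed.

(** A centre of a triangle for W is one for every dominated function. *)
Lemma dominated_center psi : dominated psi -> exists2 C : R, 0 <= C &
  forall x y z, exists c, [/\ gromov_product W c x y <= delta + 1,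
    gromov_product W c x z <= delta + 1, gromov_product W c y z <= delta + 1 &
    [/\ `|gromov_product psi c x y| <= C, `|gromov_product psi c x z| <= C &
        `|gromov_product psi c y z| <= C]].
Proof.
have dl0 := delta0.
move=> [pL pC pd [l l0 hl]]; exists (l * (delta + 1) + l).
  by apply: addr_ge0 => //; apply: mulr_ge0 => //; lra.
move=> x y z; have [c [h1 h2 h3]] := word_center_exists x y z.
have {}h1 : gromov_product W c x y <= delta + 1 by rewrite h1; lra.
by exists c; split => //; split; apply: le_trans (hl _ _ _) _;
  rewrite lerD2r ler_wpM2l.
Qed.

(** Split the three values at a centre [c]: the defect of the triangle inequality is
then [-2 * psi y c] up to constants. *)
Lemma rough_triangle psi B : dominated psi -> (forall x y, - B <= psi x y) ->
  exists2 C : R, 0 <= C & forall x y z, psi x z <= psi x y + psi y z + C.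
Proof.
move=> pD hB; have [C C0 hC] := dominated_center pD.
have pC : forall x y, psi x y = psi y x by case: pD.
exists (`|2 * B + 6 * C|) => // x y z.
have [c [_ _ _ [h1 h2 h3]]] := hC x y z.
have := product_rebase y x z c pC; rewrite (product_sym c z y pC).
move: h1 h2 h3; rewrite !ler_norml => /andP[? ?] /andP[? ?] /andP[? ?].
have := hB y c; have := ler_norm (2 * B + 6 * C).
by rewrite {1}/gromov_product (pC y z); lra.
Qed.

(** Let [c] be a centre of [z], [a], [w] where [a] has the smaller W-product with [w].
Then [c] lies close to geodesics from [z] to each of [a], [w] and [b], so both
[(a|w)_z] and, from below, [(a|b)_z] are comparable to [d z c]. *)
Lemma dominated_hyperbolic d : is_pseudo_metric d -> dominated d -> is_hyperbolic d.
Proof.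
move=> dP dD; have [C C0 hC] := dominated_center dD.
have dl0 := delta0.
have [_ _ dC _] := dP.
have [_ _ _ [l l0 hl]] := dD.
pose k := delta + 1.
pose K := l * (2 * k + delta) + l + C + C + C.
have K0 : 0 <= K.
  have : 0 <= l * (2 * k + delta) by apply: mulr_ge0 => //; rewrite /k; lra.
  by rewrite /K; lra.
exists K => // x y z w.
suff key a b : gromov_product W z a w <= gromov_product W z w b ->
    gromov_product d z a w <= gromov_product d z a b + K.
  rewrite lerBlDr ge_min.
  have [h|h] := leP (gromov_product W z x w) (gromov_product W z w y).
    by rewrite key.
  rewrite (product_sym z w y dC) (product_sym z x y dC).
  by rewrite [X in _ || X]key ?orbT // product_sym // (product_sym z w x) // ltW.
move=> hab.
have [c [h1 h2 h3 [d1 d2 d3]]] := hC a w z.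
have e1 := product_rebase z a w c WC; have e2 := product_rebase z a w c dC.
have g1 : W z c - 2 * k <= gromov_product W z a w.
  by have := product_ge0 c a w WP; move: h1 h2 h3; rewrite -/k; lra.
have cw := product_add z c w WC.
have hcw : W z c - k <= gromov_product W z c w.
  by move: h3; rewrite (product_sym c w z WC) -/k; lra.
have hcb : W z c - 2 * k - delta <= gromov_product W z c b.
  by have := four_point_product WC WH z c b w; rewrite -/k in h1 *; move=> [] ?; rewrite /k in g1 hcw *; lra.
have hbz : gromov_product W c z b <= 2 * k + delta.
  by have := product_add z c b WC; lra.
have hdb : gromov_product d c z b <= l * (2 * k + delta) + l.
  apply: le_trans (ler_norm _) _; apply: le_trans (hl _ _ _) _.
  by rewrite lerD2r ler_wpM2l.
have e3 := product_rebase z a b c dC.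
rewrite (product_sym c b z dC) in e3.
have := product_ge0 c a b dP.
move: d1 d2 d3; rewrite !ler_norml => /andP[? ?] /andP[? ?] /andP[? ?].
by rewrite /K; lra.
Qed.

End Dominated.

(** * Elements of the space of metrics *)

Section MetricsD.
Context {R : realType} {G : groupType}.
Variables (S : set G) (len : G -> nat) (delta : R).
Hypotheses (hS : finite_symmetric_generating S) (hlen : is_word_length len).
Local Notation W := (@word_dist G R len).
Hypotheses (SW : forall x y, word_metric S x y = W x y).
Hypotheses (delta0 : 0 <= delta) (WH : four_point W delta).
Implicit Types (d psi phi : G -> G -> R).

Let WP : is_pseudo_metric W := word_dist_pseudo_metric hlen.
Let WC := pseudo_metric_sym WP.

Lemma metricsD_coercive d : metricsD d ->
  exists eps B : R, [/\ 0 < eps, 0 <= B & forall x y, eps * W x y - B <= d x y].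
Proof.
move=> [_ _ _ [S' hS' [L [c [L1 c0 hd]]]]].
have [len' hlen' [_ SW']] := word_length_exists hS'.
have [A A0 hA] := len_lipschitz (R := R) hlen' WP (word_dist_left_invariant len).
have LA : 0 < L * (A + 1) by apply: mulr_gt0; lra.
exists (L * (A + 1))^-1, c; split => //; first by rewrite invr_gt0.
move=> x y; have [+ _] := hd x y; apply: le_trans; rewrite lerD2r.
rewrite ler_pdivrMl // mulrACA mulfV; last by rewrite gt_eqF; lra.
rewrite mul1r SW'; apply: le_trans (hA x y) _.
by rewrite mulrDl mul1r lerDl; case: (word_dist_pseudo_metric (R := R) hlen').
Qed.

Lemma coercive_metricsD d eps B : is_pseudo_metric d -> left_invariant d ->
  dominated len d -> 0 < eps -> (forall x y, eps * W x y - B <= d x y) -> metricsD d.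
Proof.
move=> dP dL dD eps0 hB; split => //; first exact: (dominated_hyperbolic hlen delta0 WH).
exists S => //; have [A A0 hA] := len_lipschitz hlen dP dL.
exists (A + eps^-1 + 1), `|B|; split => //.
  have : 0 < eps^-1 by rewrite invr_gt0.
  lra.
move=> x y; have W0 : 0 <= W x y by case: WP.
have e0 : 0 < eps^-1 by rewrite invr_gt0.
rewrite SW; split.
  apply: le_trans (hB x y); apply: lerB; last exact: ler_norm.
  apply: ler_wpM2r => //; rewrite -[leRHS]invrK lef_pV2 ?posrE //; lra.
apply: le_trans (hA x y) _; rewrite -[leLHS]addr0; apply: lerD => //.
by apply: ler_wpM2r => //; lra.
Qed.

(** On a W-geodesic this is the stability of quasi-geodesics. A general base point
is first moved to a centre of its triangle on the geodesic, at a distance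
bounded by the W-product. *)
Lemma metricsD_dominated d : metricsD d -> dominated len d.
Proof.
have del0 := delta0; move=> dM; have [eps [B [eps0 B0 hB]]] := metricsD_coercive dM.
case: dM => dP dL dHyp _.
have [_ _ dC dT] := dP.
have [dl dl0 dH] := hyperbolic_four_point dC dHyp.
have [A A0 hA] := len_lipschitz hlen dP dL.
have e0 : 0 <= eps^-1 by rewrite invr_ge0 ltW.
have [C C0 hC] := @quasigeodesic_product_bounded R G _ _ _ _ e0 (mulr_ge0 e0 B0) A0 dl0.
apply: (dominated_metric (lam := A + C + A * (2 * (delta + 1))) hlen dP dL).
move=> x y.
have [p [p0 pn hp]] := @word_geodesic G R len hlen x y.
have [i lein [h1 h2]] := word_center hlen WH 1%g p0 pn hp.
have g0 : gromov_product d (p i) x y <= C.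
  rewrite -p0 -pn; apply: hC => // [j jn|j k jk].
    by apply: le_trans (hA _ _) _; rewrite hp ?leqnSn // subSnn mulr1.
  rewrite -hp // -mulrDr ler_pdivlMl //.
  by have := hB (p j) (p k); lra.
have c0 := product_rebase 1%g x y (p i) WC.
have g1 := product_ge0 (p i) x y WP.
apply: le_trans (product_lipschitz_base _ (p i) _ _ dP) _.
have := hA 1%g (p i).
have W1 : W 1%g (p i) <= gromov_product W 1%g x y + 2 * (delta + 1) by lra.
have := ler_wpM2l A0 W1; rewrite mulrDr.
have : 0 <= C * gromov_product W 1%g x y by apply: mulr_ge0 => //; exact: product_ge0.
have : 0 <= (A * (2 * (delta + 1))) * gromov_product W 1%g x y.
  apply: mulr_ge0; last exact: product_ge0.
  by apply: mulr_ge0 => //; lra.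
by rewrite !mulrDl; lra.
Qed.

Lemma closureD_dominated d : closureD d -> dominated len d.
Proof.
move=> [dP dL _ [lam [d0 [lam0 d0D hd]]]].
have [_ _ _ [m m0 hm]] := metricsD_dominated d0D.
apply: (dominated_metric (lam := lam * m + lam) hlen dP dL).
move=> x y; apply: le_trans (hd x y) _; rewrite addrA lerD2r.
have := le_trans (ler_norm _) (hm 1%g x y).
move=> /(ler_wpM2l (ltW lam0)); rewrite mulrDr mulrDl -!mulrA.
have : 0 <= lam * gromov_product W 1%g x y.
  by apply: mulr_ge0; [exact: ltW|exact: product_ge0].
lra.
Qed.

(** Adding a large constant off the diagonal makes a coercive function nonnegative
and absorbs the defect of the triangle inequality. *)
Lemma metricsD_near psi eps B : dominated len psi -> 0 < eps ->
  (forall x y, eps * W x y - B <= psi x y) ->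
  exists2 d, metricsD d & bounded_distance d psi.
Proof.
move=> pD eps0 hB.
have B' x y : - B <= psi x y.
  apply: le_trans (hB x y); rewrite -[leLHS]add0r lerD2r.
  by apply: mulr_ge0; [exact: ltW|case: WP].
have [C C0 hC] := rough_triangle hlen delta0 WH pD B'.
have [pL pC pd _] := pD.
pose K := `|B| + C.
have K0 : 0 <= K by exact: addr_ge0.
have pK x y : 0 <= psi x y + K.
  by have := B' x y; have := ler_norm B; rewrite /K; lra.
pose d x y := if x == y then 0 else psi x y + K.
have dL : left_invariant d.
  by move=> z x y; rewrite /d (inj_eq (mulgI z)) pL.
have dP : is_pseudo_metric d.
  split => [x y|x|x y|x y z]; rewrite /d.
  - by case: ifP.
  - by rewrite eqxx.
  - by rewrite eq_sym pC.
  - have [->|xz] := eqVneq x z.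
      rewrite (eq_sym z y) (pC z y); case: ifP => _; rewrite ?addr0 //.
      by rewrite addr_ge0.
    have [xy|xy] := eqVneq x y; first by rewrite -xy (negPf xz) add0r.
    have [yz|yz] := eqVneq y z; first by rewrite yz addr0.
    by have := hC x y z; have := normr_ge0 B; rewrite /K; lra.
have dbd : bounded_distance d psi.
  exists K => x y; rewrite /d; case: eqVneq => [->|_].
    by rewrite pd subrr normr0.
  by rewrite addrAC subrr add0r ger0_norm.
exists d => //.
have [_ dd dC _] := dP.
apply: (@coercive_metricsD d eps `|B|) => //.
  exact: dominated_bounded pD dL dC dd dbd.
move=> x y; rewrite /d; case: eqVneq => [->|_].
  by rewrite (_ : W y y = 0) ?mulr0 ?sub0r ?oppr_le0 //; case: WP.
by have := hB x y; have := ler_norm B; have := normr_ge0 B; rewrite /K; lra.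
Qed.

End MetricsD.

(** * Stable translation lengths *)

Section TranslationLength.
Context {R : realType} {G : groupType}.
Implicit Types (d : G -> G -> R).

(** Fekete's lemma, with the limit realized as the infimum. *)
Lemma subadditive_cvg (a : nat -> R) : (forall n, 0 <= a n) ->
  (forall m n, a (m + n)%N <= a m + a n) ->
  exists L : R, [/\ 0 <= L, (fun n : nat => n%:R^-1 * a n) @ \oo --> L
              & forall n, n%:R * L <= a n].
Proof.
move=> a0 aD.
pose X := [set n.+1%:R^-1 * a n.+1 | n in [set: nat]].
have X0 : lbound X 0 by move=> _ [n _ <-]; apply: mulr_ge0.
have Xne : X !=set0 by exists (1%:R^-1 * a 1%N), 0%N.
have hX : has_inf X by split => //; exists 0.
pose L := inf X.
have L0 : 0 <= L by exact: lb_le_inf.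
have LX n : L <= n.+1%:R^-1 * a n.+1 by apply: ge_inf; [exists 0|exists n].
have Ln n : n%:R * L <= a n.
  by case: n => [|n]; rewrite ?mul0r // -ler_pdivlMl.
exists L; split => //.
apply/cvgrPdist_le => eps eps0.
have [_ [m _ <-]] := inf_adherent (divr_gt0 eps0 (ltr0Sn R 1)) hX.
rewrite -/L ltr_pdivrMl // => hm.
pose B := \sum_(r < m.+1) a r.
have aB r : (r < m.+1)%N -> a r <= B.
  move=> rm; rewrite /B (bigD1 (Ordinal rm)) //= lerDl; exact: sumr_ge0.
have B0 : 0 <= B by exact: sumr_ge0.
have amul q r : a (q * m.+1 + r)%N <= q%:R * a m.+1 + a r.
  elim: q => [|q IH]; first by rewrite mul0n add0n mul0r add0r.
  rewrite mulSn -addnA; apply: le_trans (aD _ _) _.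
  by rewrite -natr1 mulrDl mul1r; lra.
near=> n.
have n0 : (0 < n)%N by near: n; exact: nbhs_infty_gt.
have nR : 0 < n%:R :> R by rewrite ltr0n.
have nB : B / (eps / 2) <= n%:R by near: n; exact: nbhs_infty_ger.
have nB' : B <= n%:R * (eps / 2).
  by move: nB; rewrite ler_pdivrMr // divr_gt0.
rewrite distrC ger0_norm; last by rewrite subr_ge0 ler_pdivlMl.
rewrite lerBlDr ler_pdivrMl //.
have := amul (n %/ m.+1)%N (n %% m.+1)%N; rewrite -divn_eq.
have := aB (n %% m.+1)%N (ltn_pmod n (ltn0Sn m)).
have q1 : (n %/ m.+1)%:R * a m.+1 <= n%:R * (L + eps / 2).
  apply: le_trans (_ : (n %/ m.+1)%:R * (m.+1%:R * (L + eps / 2)) <= _).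
    by apply: ler_wpM2l => //; exact: ltW.
  rewrite mulrA -natrM; apply: ler_wpM2r; last by rewrite ler_nat leq_divM.
  by rewrite addr_ge0 // divr_ge0 // ltW.
by move: q1 nB'; rewrite !mulrDr; lra.
Unshelve. all: by end_near. Qed.

Lemma left_invariant_mul d x y : left_invariant d -> d x (x * y)%g = d 1%g y.
Proof. by move=> dL; rewrite -{1}(mulg1 x) dL. Qed.

Lemma left_invariant_inv d x : left_invariant d -> (forall x y, d x y = d y x) ->
  d 1%g x^-1%g = d 1%g x.
Proof. by move=> dL dC; rewrite -(dL x) mulg1 mulgV dC. Qed.

Section Basic.
Variables (d : G -> G -> R) (dP : is_pseudo_metric d) (dL : left_invariant d).

Lemma translation_length_exists x :
  [/\ 0 <= translation_length d x,
      (fun n : nat => n%:R^-1 * d 1%g (x ^+ n)%g) @ \oo --> translation_length d x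
    & forall n, n%:R * translation_length d x <= d 1%g (x ^+ n)%g].
Proof.
have [d0 dd dC dT] := dP.
have [||L [L0 hL Ln]] := @subadditive_cvg (fun n => d 1%g (x ^+ n)%g).
- by move=> n; exact: d0.
- move=> m n; rewrite expgnDr; apply: le_trans (dT _ (x ^+ m)%g _) _.
  by rewrite left_invariant_mul.
by have -> : translation_length d x = L by exact: cvg_lim.
Qed.

Lemma translation_length_ge0 x : 0 <= translation_length d x.
Proof. by case: (translation_length_exists x). Qed.

Lemma translation_length_le x : translation_length d x <= d 1%g x.
Proof.
by have [_ _ /(_ 1%N)] := translation_length_exists x; rewrite mul1r expg1.
Qed.

Lemma translation_length_torsion x n : (0 < n)%N -> (x ^+ n = 1)%g ->
  translation_length d x = 0.
Proof.
move=> n0 xn; have [h0 _ /(_ n)] := translation_length_exists x.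
have [_ dd _ _] := dP.
rewrite xn dd pmulr_rle0 ?ltr0n // => h1.
by apply/eqP; rewrite eq_le h1.
Qed.

(** If the square of [x] moves the identity further than [x] does, by more than
[2 * delta], the four-point condition on the points 1, x, x ^ 2, x ^ (n + 2)
propagates this gain to every next power. *)
Lemma translation_length_ge delta x : four_point d delta ->
  d 1%g x - 2 * gromov_product d 1%g x x^-1%g - 2 * delta <= translation_length d x.
Proof.
move=> dH; have [d0 dd dC dT] := dP.
pose a n := d 1%g (x ^+ n)%g.
have a2 : d x^-1%g x = a 2 by rewrite -(dL x) mulgV -expg2.
have -> : d 1%g x - 2 * gromov_product d 1%g x x^-1%g - 2 * delta =
    a 2 - a 1 - 2 * delta.
  rewrite /gromov_product (dC x) (dC x) a2 left_invariant_inv // /a expg1; lra.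
set eps := _ - _ - _.
have [eps0|eps0] := leP eps 0; first exact: le_trans (translation_length_ge0 x).
have incr n : a n + eps <= a n.+1.
  elim: n => [|n IH].
    have : a 2 <= a 1 + a 1.
      rewrite /a expg2 expg1; apply: le_trans (dT _ x _) _.
      by rewrite left_invariant_mul.
    have : 0 <= a 1 by exact: d0.
    have -> : a 0%N = 0 by exact: dd.
    rewrite /eps; have : 0 <= delta.
      by have := dH x x x x; rewrite !dd => -[]; lra.
    by lra.
  have := dH 1%g (x ^+ 2)%g x (x ^+ n.+2)%g.
  rewrite (_ : d x (x ^+ n.+2)%g = a n.+1); last first.
    by rewrite expgS left_invariant_mul.
  rewrite (_ : d (x ^+ 2)%g (x ^+ n.+2)%g = a n); last first.
    by rewrite -(add2n n) expgnDr left_invariant_mul.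
  rewrite (_ : d (x ^+ 2)%g x = a 1); last first.
    by rewrite dC expg2 left_invariant_mul // /a expg1.
  rewrite -/(a 2) -/(a n.+2) (_ : d 1%g x = a 1); last by rewrite /a expg1.
  by move: IH eps0; rewrite /eps => ? ? [] ?; lra.
have an n : n%:R * eps <= a n.
  elim: n => [|n IH]; first by rewrite mul0r; exact: d0.
  by rewrite -natr1 mulrDl mul1r; have := incr n; lra.
have [_ hc _] := translation_length_exists x.
rewrite -(cvg_lim (@Rhausdorff R) hc); apply: limr_ge.
  by apply/cvg_ex; exists (translation_length d x).
near=> n.
have n0 : (0 < n)%N by near: n; exact: nbhs_infty_gt.
by rewrite ler_pdivlMl ?ltr0n //; exact: an.
Unshelve. all: by end_near. Qed.

End Basic.

Lemma translation_length_combination d d1 d2 (t s C : R) x :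
  is_pseudo_metric d -> left_invariant d ->
  is_pseudo_metric d1 -> left_invariant d1 ->
  is_pseudo_metric d2 -> left_invariant d2 ->
  (forall y, `|d 1%g y - (t * d1 1%g y + s * d2 1%g y)| <= C) ->
  translation_length d x = t * translation_length d1 x + s * translation_length d2 x.
Proof.
move=> dP dL d1P d1L d2P d2L hC.
have [_ h _] := translation_length_exists dP dL x.
have [_ h1 _] := translation_length_exists d1P d1L x.
have [_ h2 _] := translation_length_exists d2P d2L x.
have h0 : (fun n : nat => n%:R^-1 *
    (d 1%g (x ^+ n)%g - (t * d1 1%g (x ^+ n)%g + s * d2 1%g (x ^+ n)%g)))
    @ \oo --> (0 : R).
  apply/cvgrPdist_le => eps eps0.
  near=> n.
  have n0 : (0 < n)%N by near: n; exact: nbhs_infty_gt.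
  have nR : 0 < n%:R :> R by rewrite ltr0n.
  have nB : C / eps <= n%:R by near: n; exact: nbhs_infty_ger.
  rewrite sub0r normrN normrM gtr0_norm ?invr_gt0 // ler_pdivrMl //.
  by apply: le_trans (hC _) _; rewrite -ler_pdivrMr.
have h3 : (fun n : nat => n%:R^-1 *
    (d 1%g (x ^+ n)%g - (t * d1 1%g (x ^+ n)%g + s * d2 1%g (x ^+ n)%g)))
    @ \oo --> (translation_length d x -
      (t * translation_length d1 x + s * translation_length d2 x)).
  have -> : (fun n : nat => n%:R^-1 *
    (d 1%g (x ^+ n)%g - (t * d1 1%g (x ^+ n)%g + s * d2 1%g (x ^+ n)%g))) =
    (fun n : nat => n%:R^-1 * d 1%g (x ^+ n)%g -
     (t * (n%:R^-1 * d1 1%g (x ^+ n)%g) + s * (n%:R^-1 * d2 1%g (x ^+ n)%g))).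
    by apply/funext => n; rewrite mulrBr mulrDr (mulrCA t) (mulrCA s).
  apply: cvgB => //; apply: cvgD; apply: cvgM => //; exact: cvg_cst.
apply/eqP; rewrite -subr_eq0; apply/eqP.
by rewrite -(cvg_lim (@Rhausdorff R) h3) (cvg_lim (@Rhausdorff R) h0).
Unshelve. all: by end_near. Qed.

End TranslationLength.

(** * Growth of non-elementary groups *)

Section CyclicSubgroup.
Context {G : groupType}.
Variables (h : G).
Hypotheses (h_inf : forall n, (0 < n)%N -> (h ^+ n <> 1)%g).

Lemma expg_inj m n : (h ^+ m = h ^+ n)%g -> m = n.
Proof.
wlog mn : m n / (m <= n)%N.
  by move=> H e; case: (leqP m n) => [mn|/ltnW nm]; [|symmetry]; exact: H.
move=> e; apply/eqP; rewrite eqn_leq mn /= leqNgt; apply/negP => ltmn.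
apply: (@h_inf (n - m)); first by rewrite subn_gt0.
by rewrite expgnFr // -e mulgV.
Qed.

Lemma coset_representatives M : ~ virtually_cyclic G ->
  exists s : seq G, [/\ uniq s, size s = M &
    forall x y, x \in s -> y \in s -> forall m n,
      (x * h ^+ m = y * h ^+ n)%g -> x = y].
Proof.
move=> hne; elim: M => [|M [s [us ss hs]]]; first by exists [::].
have [x hx] : exists x, forall c, c \in s -> forall n : nat,
    ~ (x = (c * h ^+ n)%g \/ x = (c * h ^- n)%g).
  apply: contrapT => nx; apply: hne; exists h, [set` s]; split => //.
  move=> x; apply: contrapT => hx; apply: nx; exists x => c cs n hc.
  by apply: hx; exists c; split => //; exists n.
have xc c m n : c \in s -> (x * h ^+ m <> c * h ^+ n)%g.
  move=> cs e.
  have {}e : x = (c * (h ^+ n / h ^+ m))%g by rewrite mulgA -e mulgK.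
  have [mn|nm] := leqP m n.
    by apply: (hx c cs (n - m)%N); left; rewrite e expgnFr.
  apply: (hx c cs (m - n)%N); right.
  by rewrite e expgnFr ?invgF // ltnW.
exists (x :: s); split => /=; last 1 first.
- move=> y z; rewrite !inE => /orP[/eqP->|ys] /orP[/eqP->|zs] // m n e.
  + by case: (xc z m n zs).
  + by case: (xc y n m ys); rewrite e.
  + exact: hs e.
- rewrite us andbT; apply/negP => xs.
  by case: (xc x 0%N 0%N xs).
- by rewrite ss.
Qed.

Variables (len : G -> nat) (hlen : is_word_length len).

Lemma len_expg n : (len (h ^+ n)%g <= n * len h)%N.
Proof.
elim: n => [|n IH]; first by rewrite expg0 mul0n (len1 hlen).
by rewrite expgS mulSn; apply: leq_trans (lenM hlen _ _) _; rewrite leq_add2l.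
Qed.

Lemma long_element N : exists g, (N <= len g)%N.
Proof.
apply: contrapT => nolong; have [l hl] := len_ball_finite hlen N.
have sub : {subset [seq (h ^+ k)%g | k <- iota 0 (size l).+1] <= l}.
  move=> _ /mapP[k _ ->]; apply: hl; apply: ltnW; rewrite ltnNge; apply/negP => Nk.
  by apply: nolong; exists (h ^+ k)%g.
have : uniq [seq (h ^+ k)%g | k <- iota 0 (size l).+1].
  by rewrite map_inj_uniq ?iota_uniq // => m n; exact: expg_inj.
by move=> /uniq_leq_size /(_ sub); rewrite size_map size_iota ltnn.
Qed.

(** A linear bound on growth would bound the number of cosets of the infinite cyclic
group generated by [h], since each coset meets the ball of radius r in a number
of points proportional to r. The slope [2 * r + 1] is the number of integer
depths in [aligned_count]. *)
Lemma superlinear_growth (K : nat) : ~ virtually_cyclic G ->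
  exists r (E : seq G), [/\ uniq E, forall e, e \in E -> (len e <= r)%N
    & (K * (2 * r + 1) < size E)%N].
Proof.
move=> hne.
have [s [us ss hs]] := coset_representatives (2 * K * len h).+1 hne.
pose m := \max_(c <- s) len c.
pose n := (2 * K * m + K + 1)%N.
exists (m + n * len h)%N, [seq (c * h ^+ k)%g | c <- s, k <- iota 0 n]; split.
- apply: allpairs_uniq => //; first exact: iota_uniq.
  move=> [c k] [c' k'] /allpairsP[[a b] [/= a1 a2 [-> ->]]].
  move=> /allpairsP[[a' b'] [/= a1' a2' [-> ->]]] e.
  have aa1 := hs _ _ a1 a1' _ _ e; subst a'.
  by congr (_, _); apply: expg_inj; apply: (mulgI a).
- move=> e /allpairsP[[c k] /= [cs]]; rewrite mem_iota => /andP[_ kn] ->.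
  apply: leq_trans (lenM hlen _ _) _; apply: leq_add.
    by rewrite /m (big_rem c) //= leq_maxl.
  apply: leq_trans (len_expg _) _; rewrite leq_mul2r; apply/orP; right.
  by rewrite ltnW.
- rewrite size_allpairs ss size_iota /n; nia.
Qed.

End CyclicSubgroup.

(** * Connecting elements *)

Section Connectors.
Context {R : realType} {G : groupType}.
Variables (len : G -> nat) (hlen : is_word_length len) (delta : R).
Local Notation W := (@word_dist G R len).
Local Notation gp := (gromov_product W 1%g).
Hypotheses (delta0 : 0 <= delta) (WH : four_point W delta).
Variables (h : G).
Hypotheses (h_inf : forall n, (0 < n)%N -> (h ^+ n <> 1)%g).
Hypothesis hne : ~ virtually_cyclic G.

Let WP : is_pseudo_metric W := word_dist_pseudo_metric hlen.
Let WC := pseudo_metric_sym WP.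
Let WL : left_invariant W := @word_dist_left_invariant G R len.

Lemma word_distE x y : W x (x * y)%g = (len y)%:R.
Proof. by rewrite left_invariant_mul // word_dist1. Qed.

(** If [e * g] follows the direction of [a] for a long time, so does the geodesic
from [e] to [e * g]; its point [e * q] far beyond [e] is then within
[6 * delta] of the geodesic from 1 to [a], at a depth known up to [r]. *)
Lemma aligned_point (r R0 : nat) a g q e :
  (len e <= r)%N -> (r <= R0)%N -> delta < (R0 - r)%:R ->
  (R0 <= len g)%N -> len q = R0 -> len (q^-1 * g)%g = (len g - R0)%N ->
  (R0 + r)%:R < gp a (e * g)%g ->
  exists z, [/\ z = (e * q)%g, (R0 - r <= len z <= R0 + r)%N,
    (len z <= len a)%N & forall y, len y = len z ->
      len (y^-1 * a)%g = (len a - len z)%N -> W z y <= 6 * delta].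
Proof.
move=> er rR dr Rg lq lqg ha; exists (e * q)%g; set z := (e * q)%g.
have dl0 := delta0.
have z1 : (len z <= R0 + r)%N.
  by apply: leq_trans (lenM hlen _ _) _; rewrite lq addnC leq_add2l.
have z2 : (R0 - r <= len z)%N.
  have := lenM hlen e^-1%g z; rewrite /z mulgA mulVg mul1g lq (lenV hlen) -/z.
  by move=> *; lia.
have za : (len z <= len a)%N.
  rewrite -(ler_nat R); apply: ltW; apply: lt_le_trans (_ : gp a (e * g)%g <= _).
    by apply: le_lt_trans ha; rewrite ler_nat.
  by rewrite -word_dist1; apply: product_le_dist.
split => //; first by rewrite z2.
move=> y ly lya.
have We : W 1%g e <= r%:R by rewrite word_dist1 ler_nat.
have Wz : W 1%g z = (len z)%:R by rewrite word_dist1.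
have Wez : W e z = R0%:R by rewrite word_distE lq.
have Weg : W e (e * g)%g = (len g)%:R by rewrite word_distE.
have Wzg : W z (e * g)%g = (len g)%:R - R0%:R.
  by rewrite -natrB // -lqg /z /word_dist invgM -mulgA (mulgA e^-1%g) mulVg mul1g.
have zR : R0%:R - r%:R <= W 1%g z by rewrite Wz -natrB // ler_nat.
have zR' : W 1%g z <= R0%:R + r%:R by rewrite Wz -natrD ler_nat.
rewrite natrB // in dr; rewrite natrD in ha.
have s1 : gromov_product W z 1%g (e * g)%g <= delta.
  have := four_point_product WC WH z e (e * g)%g 1%g.
  by rewrite {1 2 4}/gromov_product Wez Weg Wzg (WC e 1%g) (WC z 1%g); move=> []; lra.
have s2 : W 1%g z - delta <= gp z (e * g)%g.
  by have := product_add 1%g z (e * g)%g WC; lra.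
have s3 : W 1%g z - 2 * delta <= gp z a.
  have := four_point_product WC WH 1%g z a (e * g)%g.
  by rewrite (product_sym 1%g (e * g)%g a WC); move=> []; lra.
have Wy : W 1%g y = W 1%g z by rewrite Wz word_dist1 ly.
have s4 : gp a y = W 1%g z.
  rewrite /gromov_product Wy (WC a 1%g) (WC a y) /word_dist.
  rewrite lya natrB //  -[(len z)%:R]Wz invg1 !mul1g; lra.
have s5 : W 1%g z - 3 * delta <= gp z y.
  by have := four_point_product WC WH 1%g z y a; rewrite s4; move=> []; lra.
by move: s5; rewrite {1}/gromov_product Wy (WC z 1%g); lra.
Qed.

(** By [aligned_point] such an [e] is determined by a depth, of which there are
[2 * r + 1], and by an element of a ball of fixed radius. *)
Lemma aligned_count : exists K : nat, forall (r R0 : nat) a g (E : seq G),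
  uniq E -> (forall e, e \in E -> (len e <= r)%N) ->
  (r <= R0)%N -> delta < (R0 - r)%:R -> (R0 <= len g)%N ->
  (forall e, e \in E -> (R0 + r)%:R < gp a (e * g)%g) ->
  (size E <= K * (2 * r + 1))%N.
Proof.
have [B hB] := len_ball_finite hlen (Num.truncn (6 * delta)).
exists (size B) => r R0 a g E uE hE rR dr Rg hal.
have [q lq lqg] := len_split hlen Rg.
have [p [p0 pn hp]] := @word_geodesic G R len hlen 1%g a.
rewrite invg1 mul1g in pn hp.
pose f ib := (p (R0 - r + ib.1)%N * ib.2 * q^-1)%g.
apply: (@leq_trans (size [seq f (i, b) | i <- iota 0 (2 * r + 1), b <- B])); last first.
  by rewrite size_allpairs size_iota mulnC.
apply: uniq_leq_size => // e eE.
have [z [zE /andP[z1 z2] za hz]] := aligned_point (hE e eE) rR dr Rg lq lqg (hal e eE).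
have lpz : len (p (len z)) = len z.
  apply/eqP; rewrite -(eqr_nat R) -word_dist1 -{1}p0 hp ?subn0 //.
have lpza : len ((p (len z))^-1 * a)%g = (len a - len z)%N.
  by apply/eqP; rewrite -(eqr_nat R) -(hp (len z) (len a)) ?za ?leqnn // pn.
have := hz _ lpz lpza; rewrite WC => hzp.
apply/allpairsP; exists ((len z - (R0 - r))%N, ((p (len z))^-1 * z)%g) => /=.
split.
- rewrite mem_iota add0n /=; lia.
- apply: hB.
  by rewrite -ltnS -(ltr_nat R); apply: le_lt_trans hzp (truncnS_gt _).
- by rewrite /f /= subnKC // mulgA mulgV mul1g zE mulgK.
Qed.

(** Pigeonhole: a set that outgrows twice the bound of [aligned_count] has an element
aligned with neither of two given directions. *)
Lemma avoid_two : exists (r C0 : nat) (E : seq G),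
  (forall e, e \in E -> (len e <= r)%N) /\
  forall g, (C0 <= len g)%N -> forall a c,
    exists e, [/\ e \in E, gp a (e * g)%g <= C0%:R & gp c (e * g)%g <= C0%:R].
Proof.
have [K hK] := aligned_count.
have [r [E [uE hE sE]]] := superlinear_growth h_inf hlen (2 * K) hne.
pose R0 := (r + (Num.truncn delta).+1)%N.
have rR : (r <= R0)%N by exact: leq_addr.
have dr : delta < (R0 - r)%:R by rewrite /R0 addKn; exact: truncnS_gt.
exists r, (R0 + r)%N, E; split => // g lg a c.
have Rg : (R0 <= len g)%N by apply: leq_trans lg; exact: leq_addr.
pose P x e := (R0 + r)%:R < gp x (e * g)%g.
have cnt x : (count (P x) E <= K * (2 * r + 1))%N.
  rewrite -size_filter; apply: (hK r R0 x g) => //.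
  - exact: filter_uniq.
  - by move=> e; rewrite mem_filter => /andP[_ /hE].
  - by move=> e; rewrite mem_filter => /andP[].
apply: contrapT => nex.
have : all (predU (P a) (P c)) E.
  apply/allP => e eE /=; apply: contrapT => /negP; rewrite negb_or /P -!leNgt.
  by move=> /andP[? ?]; apply: nex; exists e.
rewrite all_count => /eqP h1.
have sPP : (size E <= count (P a) E + count (P c) E)%N.
  by rewrite -count_predUI h1 leq_addr.
have := leq_trans sE (leq_trans sPP (leq_add (cnt a) (cnt c))).
by rewrite addnn -mul2n mulnA ltnn.
Qed.

(** Elements [f = e * g * e'^-1] with [g] long have independent directions at both
ends: [e] governs the direction of [f] and [e'] that of its inverse. The constant
does not depend on the length [N], which can therefore be taken large
compared with it. *)
Lemma connectors : exists2 C : R, 0 <= C & forall N : nat, exists2 F : seq G,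
  forall f, f \in F -> (N <= len f)%N &
  forall a b c, exists f, [/\ f \in F, gp a f <= C, gp c f <= C & gp b f^-1%g <= C].
Proof.
have [r [C0 [E [hE hav]]]] := avoid_two.
exists (C0 + r)%:R => // N.
have [g lg] := long_element h_inf hlen (C0 + (N + 2 * r))%N.
have long (e e' : G) : (len e <= r)%N -> (len e' <= r)%N ->
    (N <= len (e * g * e'^-1)%g)%N.
  move=> er er'; have h1 := lenM hlen (e^-1)%g (e * g)%g.
  rewrite mulgA mulVg mul1g (lenV hlen) in h1.
  have h2 := lenM hlen (e * g * e'^-1)%g e'; rewrite mulgVK in h2.
  clear - h1 h2 er er' lg; lia.
exists [seq (e * g * e'^-1)%g | e <- E, e' <- E].
  by move=> _ /allpairsP[[e e'] /= [/hE er /hE er' ->]]; exact: long.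
move=> a b c.
have [|e [eE ea ec]] := hav g _ a c; first exact: leq_trans (leq_addr _ _) lg.
have [|e' [eE' eb _]] := hav (g^-1)%g _ b b.
  by rewrite (lenV hlen); exact: leq_trans (leq_addr _ _) lg.
exists (e * g * e'^-1)%g; split; first by apply/allpairsP; exists (e, e').
- apply: le_trans (product_lipschitz _ _ _ (e * g)%g WP) _.
  by rewrite natrD WC word_distE (lenV hlen) lerD // ler_nat hE.
- apply: le_trans (product_lipschitz _ _ _ (e * g)%g WP) _.
  by rewrite natrD WC word_distE (lenV hlen) lerD // ler_nat hE.
- rewrite !invgM invgK mulgA.
  apply: le_trans (product_lipschitz _ _ _ (e' * g^-1)%g WP) _.
  by rewrite natrD WC word_distE (lenV hlen) lerD // ler_nat hE.
Qed.

(** Choose [f] transversal both to the inverse of [x] and, through its own inverse,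
to [x]; then the concatenation of copies of [x * f] does not backtrack. *)
Lemma cyclically_reduced : exists (C : R) (F : seq G), forall x,
  exists2 f, f \in F & gp (x * f)%g (x * f)^-1%g <= C.
Proof.
have [C C0 hC] := connectors.
have [F hF hcon] := hC (Num.truncn (2 * C + delta)).+1.
exists (C + delta + (\max_(f <- F) len f)%:R), F => x.
have [f [fF f1 _ f2]] := hcon (x^-1)%g x (x^-1)%g; exists f => //.
pose y := (f^-1 * x^-1)%g.
have yE : (x * f)^-1%g = y by rewrite invgM.
rewrite yE product_sym //; apply: le_trans (product_lipschitz _ _ _ x WP) _.
rewrite WC word_distE product_sym //; apply: lerD; last first.
  by rewrite ler_nat (big_rem f) //= leq_maxl.
have h1 := product_add 1%g (f^-1)%g y WC.
have h2 : gromov_product W f^-1%g 1%g y = gp f x^-1%g.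
  by rewrite -(product_invariant f _ _ _ WL) mulgV mulg1 /y mulgA mulgV mul1g.
have h3 : 2 * C + delta < W 1%g f^-1%g.
  rewrite word_dist1 (lenV hlen); apply: lt_le_trans (truncnS_gt _) _.
  by rewrite ler_nat hF.
have := four_point_product WC WH 1%g (f^-1)%g x y.
rewrite (product_sym 1%g (f^-1)%g x WC) (product_sym 1%g y x WC).
rewrite (product_sym 1%g f x^-1%g WC) in h2.
by move=> [] ?; lra.
Qed.

End Connectors.

(** * Free subsemigroups and divergence *)

Section Branching.
Context {R : realType} {G : groupType}.
Variables (len : G -> nat) (hlen : is_word_length len) (delta : R).
Local Notation W := (@word_dist G R len).
Local Notation gp := (gromov_product W 1%g).
Hypotheses (delta0 : 0 <= delta) (WH : four_point W delta).

Let WP : is_pseudo_metric W := word_dist_pseudo_metric hlen.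
Let WC := pseudo_metric_sym WP.
Let WL : left_invariant W := @word_dist_left_invariant G R len.

Lemma product_shift a b : gp a (a * b)%g = W 1%g a - gp a^-1%g b.
Proof.
have := product_add 1%g a (a * b)%g WC.
rewrite -(product_invariant (a^-1)%g a _ _ WL) mulVg mulgA mulVg mul1g mulg1.
by rewrite (product_sym 1%g) //; lra.
Qed.

(** Let [q i] be points at depth [N * i.+1] on a geodesic from 1 to [x], and let [f i]
leave this geodesic at [q i] transversally to both of its directions. The
elements [q i * f i] freely generate a semigroup: two words whose first letters
differ have to separate where the first of them leaves the geodesic. *)

Section FreeSemigroup.
Variables (C : R) (N M : nat) (x : G) (p f : nat -> G).
Local Notation q := (fun i => p (N * i.+1)%N).
Hypotheses (C0 : 0 <= C) (NC : 2 * C + 2 * delta < N%:R).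
Hypotheses (p0 : p 0%N = 1%g) (pn : p (N * M)%N = x).
Hypothesis hp : forall j k, (j <= k <= N * M)%N -> W (p j) (p k) = (k - j)%:R.
Hypothesis hf : forall i, (i < M)%N ->
  [/\ N%:R <= W 1%g (f i), gp (q i)^-1%g (f i) <= C,
      gp ((q i)^-1 * x)%g (f i) <= C & gp x (f i)^-1%g <= C].

Local Notation val := (fun w : seq nat => (\prod_(i <- w) (q i * f i))%g).

Let qM i : (i < M)%N -> (N * i.+1 <= N * M)%N.
Proof. by move=> iM; rewrite leq_mul2l iM orbT. Qed.

Let Wq i : (i < M)%N -> W 1%g (q i) = (N * i.+1)%:R.
Proof. by move=> iM; rewrite -p0 hp ?subn0 //= qM. Qed.

Let q_prefix i : (i < M)%N -> W 1%g (q i) + W (q i) x = W 1%g x.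
Proof.
move=> iM; rewrite Wq // -pn hp ?qM ?leqnn // -natrD subnKC ?qM //.
by rewrite -p0 hp ?subn0 // leqnn.
Qed.

Let WNle i : (i < M)%N -> N%:R <= W 1%g (q i).
Proof. by move=> iM; rewrite Wq // ler_nat leq_pmulr. Qed.

Lemma word_no_backtrack w j : all (fun i => (i < M)%N) w -> (j < M)%N ->
  gp (q j)^-1%g (f j * val w)%g <= C + delta /\
  N%:R - C - delta <= gp (f j) (f j * val w)%g.
Proof.
have dl0 := delta0; have NC' := NC; have C0' := C0.
elim: w j => [|k w IH] j.
  move=> _ jM; rewrite big_nil mulg1; have [h1 h2 h3 h4] := hf jM; split; first by lra.
  rewrite /gromov_product (_ : W (f j) (f j) = 0); last by case: WP.
  by rewrite (WC (f j)); lra.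
move=> /= /andP[kM wM] jM; rewrite big_cons -!mulgA.
have [h1 h2 h3 h4] := hf jM; have [k1 k2] := IH k wM kM.
set v := (q k * (f k * val w))%g.
have s1 : N%:R - C - delta <= gp (q k) v.
  by rewrite /v product_shift; have := WNle kM; lra.
have s2 : gp (q k) (f j)^-1%g <= C.
  by apply: le_trans h4; apply: product_prefix => //; exact: q_prefix.
have s3 : gp (f j)^-1%g v <= C + delta.
  have := four_point_product WC WH 1%g (q k) (f j)^-1%g v.
  by rewrite (product_sym 1%g v _ WC); move=> []; lra.
have s4 : N%:R - C - delta <= gp (f j) (f j * v)%g.
  by rewrite product_shift; lra.
split => //.
have := four_point_product WC WH 1%g (q j)^-1%g (f j) (f j * v)%g.
by rewrite (product_sym 1%g (f j * v)%g _ WC); move=> []; lra.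
Qed.

Lemma word_first_letter i j w w' : (i < M)%N -> (j < M)%N -> (i < j)%N ->
  all (fun i => (i < M)%N) w -> all (fun i => (i < M)%N) w' ->
  (q i * (f i * val w) = q j * (f j * val w'))%g -> False.
Proof.
move=> iM jM ij wM wM' e.
have dl0 := delta0; have NC' := NC; have C0' := C0.
pose r := ((q i)^-1 * q j)%g.
have {}e : (f i * val w = r * (f j * val w'))%g.
  by rewrite /r -mulgA -e mulgA mulVg mul1g.
have [_ i2] := word_no_backtrack wM iM; have [j1 _] := word_no_backtrack wM' jM.
have [h1 h2 h3 h4] := hf iM.
have WrE y : W r ((q i)^-1 * y)%g = W (q j) y.
  by rewrite /r WL.
have Wr : W 1%g r = (N * j.+1 - N * i.+1)%:R.
  rewrite -[LHS](WL (q i)) mulg1 /r mulgA mulgV mul1g hp // qM // andbT.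
  by rewrite leq_mul2l ltnS (ltnW ij) orbT.
have rN : N%:R <= W 1%g r by rewrite Wr -mulnBr ler_nat leq_pmulr // subn_gt0.
have r1 : gp r ((q i)^-1 * x)%g = W 1%g r.
  rewrite /gromov_product WrE (WC r) -[W 1%g (_ * x)%g](WL (q i)) mulg1 mulgA mulgV mul1g Wr natrB; last first.
    by rewrite leq_mul2l ltnS (ltnW ij) orbT.
  rewrite -!Wq //; have := q_prefix iM; have := q_prefix jM; lra.
have r2 : gp r (f i) <= C.
  apply: le_trans h3; apply: product_prefix => //.
  by move: r1; rewrite /gromov_product (WC r 1%g) (WC 1%g r); lra.
have r3 : gp r^-1%g (f j * val w')%g <= C + delta.
  apply: le_trans j1; apply: product_prefix => //.
  have e1 : W r^-1%g (q j)^-1%g = W 1%g (q i).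
    by rewrite /r invgM invgK -[X in W _ X]mulg1 WL WC.
  rewrite e1 !(left_invariant_inv _ WL WC) Wr !Wq // -natrD subnK //.
  by rewrite leq_mul2l ltnS (ltnW ij) orbT.
have r4 : N%:R - C - delta <= gp r (f i * val w)%g.
  by rewrite e product_shift; lra.
have := four_point_product WC WH 1%g r (f i) (f i * val w)%g.
by rewrite (product_sym 1%g (f i * val w)%g _ WC); move=> []; lra.
Qed.

Lemma words_free w w' : size w = size w' ->
  all (fun i => (i < M)%N) w -> all (fun i => (i < M)%N) w' ->
  val w = val w' -> w = w'.
Proof.
elim: w w' => [|i w IH] [|j w'] //= [sw] /andP[iM wM] /andP[jM wM'].
rewrite !big_cons -!mulgA => e.
have [ij|ji|ij] := ltngtP i j.
- by case: (word_first_letter iM jM ij wM wM').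
- by case: (word_first_letter jM iM ji wM' wM).
- rewrite -ij in e *; congr (_ :: _); apply: IH => //.
  exact/(mulgI (f i))/(mulgI (q i)).
Qed.

End FreeSemigroup.

Variables (h : G).
Hypotheses (h_inf : forall n, (0 < n)%N -> (h ^+ n <> 1)%g).
Hypothesis hne : ~ virtually_cyclic G.

(** Prefixes of an element with bounded [psi] also have bounded [psi], since [psi] is
almost additive and bounded below. So the generators of the free semigroup built
on a long element have [psi] bounded by a constant that does not depend on their
number M. Once M exceeds twice the exponential of this constant, the words of
length k contribute at least [2 ^ k] to the sum. *)
Lemma degenerate_divergence (psi d : G -> G -> R) (B C1 : R) :
  dominated len psi -> is_pseudo_metric d -> left_invariant d ->
  (forall x y, - B <= psi x y) ->
  (forall n, exists2 x, len x = n & psi 1%g x <= C1) ->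
  exists2 eps : R, 0 < eps & forall b : R, exists2 l : seq G, uniq l &
    b < \sum_(x <- l) expR (- (psi 1%g x + eps * d 1%g x)).
Proof.
move=> pD dP dL hB hC1.
have dl0 := delta0.
have [d0 dd dC dT] := dP.
have [pL pC pd [lam lam0 hlam]] := pD.
have [C2 C20 tri] := rough_triangle hlen delta0 WH pD hB.
have tri1 y z : psi 1%g (y * z)%g <= psi 1%g y + psi 1%g z + C2.
  by apply: le_trans (tri 1%g y _) _; rewrite left_invariant_mul.
have tri2 y z : d 1%g (y * z)%g <= d 1%g y + d 1%g z.
  by apply: le_trans (dT _ y _) _; rewrite left_invariant_mul.
have [C C0 hcon] := connectors hlen delta0 WH h_inf hne.
pose N := (Num.truncn (2 * C + 2 * delta)).+1.
have NC : 2 * C + 2 * delta < N%:R by exact: truncnS_gt.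
have [F FN hF] := hcon N.
pose PF := \sum_(y <- F) `|psi 1%g y|.
have PF1 y : y \in F -> psi 1%g y <= PF.
  move=> yF; apply: le_trans (ler_norm _) _; rewrite /PF (big_rem y) //=.
  by rewrite lerDl; exact: sumr_ge0.
(* The cost of one letter: a prefix, a connector and two triangle inequalities;
   the last summand 1 pays for the multiple of d. *)
pose c := C1 + 2 * lam + B + PF + 2 * C2 + 1.
pose M := (Num.truncn (2 * expR c)).+1.
have Mc : 2 * expR c <= M%:R by exact/ltW/truncnS_gt.
have [x lx px] := hC1 (N * M)%N.
have [p [p0 pn hp]] := @word_geodesic G R len hlen 1%g x.
rewrite invg1 mul1g lx in pn hp.
pose q i := p (N * i.+1)%N.
have /choice[f hf] : forall i, exists y : G, [/\ y \in F, gp (q i)^-1%g y <= C,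
    gp ((q i)^-1 * x)%g y <= C & gp x y^-1%g <= C] by move=> i; exact: hF.
have hf' i : (i < M)%N -> [/\ N%:R <= W 1%g (f i), gp (q i)^-1%g (f i) <= C,
    gp ((q i)^-1 * x)%g (f i) <= C & gp x (f i)^-1%g <= C].
  move=> _; have [h1 h2 h3 h4] := hf i; split => //.
  by rewrite word_dist1 ler_nat FN.
have free := words_free C0 NC p0 pn hp hf'.
pose wv (w : seq nat) := (\prod_(i <- w) (q i * f i))%g.
have pq i : (i < M)%N -> psi 1%g (q i) <= C1 + 2 * lam + B.
  move=> iM; have iM' : (N * i.+1 <= N * M)%N by rewrite leq_mul2l iM orbT.
  have g0 : gromov_product W (q i) 1%g x = 0.
    rewrite /gromov_product -{1 2}p0 -pn !hp ?subn0 ?leqnn ?iM' // natrB //.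
    lra.
  have := hlam (q i) 1%g x; rewrite g0 mulr0 add0r => /(le_trans (ler_norm _)).
  by rewrite /gromov_product; have := hB (q i) x; lra.
pose D := \sum_(i < M) d 1%g (q i * f i)%g.
have D0 : 0 <= D by exact: sumr_ge0.
have Di i : (i < M)%N -> d 1%g (q i * f i)%g <= D.
  move=> iM; rewrite /D (bigD1 (Ordinal iM)) //= lerDl; exact: sumr_ge0.
pose eps := (D + 1)^-1.
have D1 : 0 < D + 1 by lra.
have eps0 : 0 < eps by rewrite invr_gt0.
have epsD i : (i < M)%N -> eps * d 1%g (q i * f i)%g <= 1.
  by move=> iM; rewrite ler_pdivrMl // mulr1; apply: le_trans (Di i iM) _; lra.
have cost w : all (fun i => (i < M)%N) w ->
    psi 1%g (wv w) + eps * d 1%g (wv w) <= (size w)%:R * c.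
  elim: w => [|i w IH] /=.
    by move=> _; rewrite /wv big_nil pd dd !mulr0 addr0 mul0r.
  move=> /andP[iM /IH{}IH]; rewrite /wv big_cons -/(wv w) -natr1 mulrDl mul1r.
  have h1 := tri1 (q i * f i)%g (wv w); have h2 := tri1 (q i) (f i).
  have := ler_wpM2l (ltW eps0) (tri2 (q i * f i)%g (wv w)); rewrite mulrDr => h3.
  have h4 := epsD i iM; have h5 := pq i iM.
  have [/PF1 h6 _ _ _] := hf i.
  by rewrite {2}/c; lra.
exists eps => // b.
pose k := (Num.truncn b).+1.
have kb : b < 2 ^+ k.
  apply: lt_le_trans (truncnS_gt b) _; rewrite -/k -natrX ler_nat.
  exact/ltnW/ltn_expl.
pose l := [seq wv (map val (w : seq 'I_M)) | w : k.-tuple 'I_M].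
have wM (w : seq 'I_M) : all (fun i => (i < M)%N) (map val w).
  by apply/allP => _ /mapP[i _ ->]; exact: ltn_ord.
exists l.
  rewrite map_inj_uniq ?enum_uniq // => w w' e.
  apply/val_inj/(inj_map val_inj); apply: free => //.
  by rewrite !size_map !size_tuple.
have -> : \sum_(x <- l) expR (- (psi 1%g x + eps * d 1%g x)) =
   \sum_(w : k.-tuple 'I_M) expR (- (psi 1%g (wv (map val w)) + eps * d 1%g (wv (map val w)))).
  by rewrite big_map big_enum.
apply: lt_le_trans kb _.
apply: le_trans (_ : \sum_(w : k.-tuple 'I_M) expR (- (k%:R * c)) <= _); last first.
  apply: ler_sum => w _; rewrite ler_expR lerN2.
  by apply: le_trans (cost _ (wM w)) _; rewrite size_map size_tuple.
rewrite sumr_const card_tuple card_ord -[leRHS]mulr_natl natrX expRN expRM_natl.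
by rewrite ler_pdivlMr ?exprn_gt0 ?expR_gt0 // -exprMn lerXn2r ?nnegrE.
Qed.

End Branching.

(** * Exponential sums *)

Section ExpSummable.
Context {R : realType} {G : groupType}.
Implicit Types (f g : G -> R).

Definition exp_summable f : Prop :=
  exists b : R, forall l : seq G, uniq l -> \sum_(x <- l) expR (- f x) <= b.

Lemma exp_summable_esum f :
  (\esum_(x in [set: G]) (expR (- f x))%:E < +oo)%E <-> exp_summable f.
Proof.
split => [fin|[b hb]].
  exists (fine (\esum_(x in [set: G]) (expR (- f x))%:E)) => l ul.
  rewrite -lee_fin fineK; last first.
    by rewrite ge0_fin_numE // esum_ge0 // => x _; rewrite lee_fin expR_ge0.
  rewrite -sumEFin; apply: esum_ge; exists [set` l].
    by split => //; exact: finite_seq.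
  by rewrite fsbig_seq.
apply: (@le_lt_trans _ _ b%:E); last exact: ltry.
apply: ub_ereal_sup => _ [X [finX _] <-].
rewrite fsbig_finite //= sumEFin lee_fin; apply: hb; exact: finmap.fset_uniq.
Qed.

Lemma exp_summable_le f g (B : R) : (forall x, f x <= g x + B) ->
  exp_summable f -> exp_summable g.
Proof.
move=> fg [b hb]; exists (expR B * b) => l ul.
apply: le_trans (_ : expR B * \sum_(x <- l) expR (- f x) <= _); last first.
  by rewrite ler_pM2l ?expR_gt0 // hb.
rewrite mulr_sumr; apply: ler_sum => x _; rewrite -expRD ler_expR.
by have := fg x; lra.
Qed.

Lemma not_exp_summable f : (forall b : R, exists2 l : seq G, uniq l &
  b < \sum_(x <- l) expR (- f x)) -> ~ exp_summable f.
Proof.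
by move=> hl [b hb]; have [l ul] := hl b; rewrite ltNge hb.
Qed.

(** With [expR (- a)] equal to [1 / (2 * (K + 1))], the sphere of radius n contributes
at most [2 ^- n]. *)
Lemma exp_summable_len (len : G -> nat) : is_word_length len ->
  exists2 a : R, 0 < a & exp_summable (fun x => a * (len x)%:R).
Proof.
move=> [_ _ _ _ [K hK]].
pose a : R := ln (2 * K.+1%:R).
have K1 : 1 < 2 * K.+1%:R :> R.
  have : 1 <= K.+1%:R :> R by rewrite ler1n.
  lra.
have a0 : 0 < a by exact: ln_gt0.
have ea : expR (- a) = (2 * K.+1%:R)^-1.
  by rewrite expRN lnK // posrE; lra.
exists a => //; exists 2 => l ul.
pose N := (\max_(x <- l) len x).+1.
have lN x : x \in l -> (len x < N)%N.
  by move=> xl; rewrite ltnS (big_rem x) //= leq_maxl.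
have -> : \sum_(x <- l) expR (- (a * (len x)%:R)) =
    \sum_(i < N) \sum_(x <- l | len x == i) expR (- a) ^+ i.
  rewrite (exchange_big_dep xpredT) //= big_seq [RHS]big_seq.
  apply: eq_bigr => x xl.
  rewrite (bigD1 (Ordinal (lN x xl))) //= big1 ?addr0.
    by rewrite mulrC -mulrN expRM_natl.
  by move=> i /andP[/eqP xi /eqP]; case; apply: val_inj.
have half (n : nat) : \sum_(i < n) (2^-1 : R) ^+ i = 2 - 2 * (2^-1) ^+ n.
  elim: n => [|n IH]; first by rewrite big_ord0 expr0 mulr1 subrr.
  rewrite big_ord_recr /= IH exprS; lra.
apply: le_trans (_ : \sum_(i < N) (2^-1 : R) ^+ i <= _); last first.
  rewrite half gerBl; apply: mulr_ge0 => //; exact: exprn_ge0.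
apply: ler_sum => i _.
rewrite big_const_seq iter_addr_0 -[leLHS]mulr_natl.
have cnt : (count (fun x => len x == i) l <= K ^ i)%N.
  have [s ss hs] := hK i; apply: leq_trans ss; rewrite -size_filter.
  apply: uniq_leq_size; first exact: filter_uniq.
  by move=> x; rewrite mem_filter => /andP[/eqP/hs].
rewrite ea invfM exprMn mulrCA -[leRHS]mulr1; apply: ler_wpM2l.
  exact: exprn_ge0.
rewrite exprVn ler_pdivrMr ?exprn_gt0 // mul1r -natrX ler_nat.
apply: leq_trans cnt _; case: (nat_of_ord i) => [|j]; rewrite ?expn0 //.
by rewrite leq_exp2r.
Qed.

End ExpSummable.

(** * The length spectrum controls the metric *)

Section Spectrum.
Context {R : realType} {G : groupType}.
Variables (len : G -> nat) (hlen : is_word_length len) (delta : R).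
Local Notation W := (@word_dist G R len).
Hypotheses (delta0 : 0 <= delta) (WH : four_point W delta).
Variables (h : G).
Hypotheses (h_inf : forall n, (0 < n)%N -> (h ^+ n <> 1)%g).
Hypothesis hne : ~ virtually_cyclic G.

(** The same [phi] serves every [d]: the elements provided by [cyclically_reduced]
have bounded W-product with their inverses, hence bounded [d]-product. *)
Lemma spectrum_determines : exists phi : G -> G, forall d,
  is_pseudo_metric d -> left_invariant d -> dominated len d ->
  exists C : R, forall x, `|translation_length d (phi x) - d 1%g x| <= C.
Proof.
have [C [F hF]] := cyclically_reduced hlen delta0 WH h_inf hne.
have /choice[f hf] : forall x, exists f, f \in F /\
    gromov_product W 1%g (x * f)%g (x * f)^-1%g <= C.
  by move=> x; have [f] := hF x; exists f.
exists (fun x => (x * f x)%g) => d dP dL dD.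
have [_ _ _ [l l0 hl]] := dD.
have [d0 dd dC dT] := dP.
have [dl dl0 dH] := hyperbolic_four_point dC (dominated_hyperbolic hlen delta0 WH dP dD).
pose PF := \sum_(y <- F) d 1%g y.
have PF1 y : y \in F -> d 1%g y <= PF.
  move=> yF; rewrite /PF (big_rem y) //= lerDl; exact: sumr_ge0.
exists (PF + 2 * (l * C + l) + 2 * dl) => x.
have [/PF1 fF hg] := hf x; set y := (x * f x)%g in hg *.
have h1 := translation_length_le dP dL y.
have h2 := translation_length_ge dP dL y dH.
have h3 : gromov_product d 1%g y y^-1%g <= l * C + l.
  apply: le_trans (ler_norm _) _; apply: le_trans (hl _ _ _) _.
  by rewrite lerD2r ler_wpM2l.
have h4 : d 1%g y <= d 1%g x + d 1%g (f x).
  by rewrite -(left_invariant_mul x (f x) dL); exact: dT.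
have h5 : d 1%g x <= d 1%g y + d 1%g (f x).
  by rewrite -(left_invariant_mul x (f x) dL) (dC x); exact: dT.
have h6 : 0 <= l * C + l.
  by apply: le_trans h3; exact: product_ge0.
by rewrite ler_norml; apply/andP; split; lra.
Qed.

(** If [psi] exceeds [2 * lam + 1] on some sphere of radius n, cutting geodesics into
pieces of length n gives [psi] linear growth. *)
Lemma degenerate_or_coercive psi (B : R) : dominated len psi ->
  (forall x y, - B <= psi x y) ->
  (exists eps B' : R, 0 < eps /\ forall x y, eps * W x y - B' <= psi x y) \/
  (exists C1 : R, forall n, exists2 x, len x = n & psi 1%g x <= C1).
Proof.
move=> pD hB; have [pL pC pd [l l0 hl]] := pD.
have [|nC1] := pselect (exists C1 : R, forall n, exists2 x, len x = n & psi 1%g x <= C1).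
  by right.
left; have /existsNP[n hn] : ~ forall n, exists2 x, len x = n & psi 1%g x <= 2 * l + 1.
  by move=> H; apply: nC1; exists (2 * l + 1).
have {}hn x : len x = n -> 2 * l + 1 < psi 1%g x.
  by move=> lx; rewrite ltNge; apply/negP => px; apply: hn; exists x.
have n0 : (0 < n)%N.
  case: n hn => // /(_ 1%g (len1 hlen)); rewrite pd; lra.
have nR : 0 < n%:R :> R by rewrite ltr0n.
have key k x : (len x <= k)%N -> (len x)%:R / n%:R - (B + 1) <= psi 1%g x.
  elim: k x => [|k IH] x.
    rewrite leqn0 => /eqP ->; rewrite mul0r sub0r.
    by have := hB 1%g x; lra.
  move=> lx; have [xn|nx] := ltnP (len x) n.
    have : (len x)%:R / n%:R <= 1 :> R by rewrite ler_pdivrMr // mul1r ler_nat ltnW.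
    by have := hB 1%g x; lra.
  have [y ly lyx] := len_split hlen nx.
  have h1 := hn y ly.
  have h2 : psi y x = psi 1%g (y^-1 * x)%g by rewrite -[RHS](pL y) mulg1 mulgA mulgV mul1g.
  have h3 : (len (y^-1 * x)%g)%:R / n%:R - (B + 1) <= psi 1%g (y^-1 * x)%g.
    apply: IH; rewrite lyx; move: lx n0; clear; lia.
  have h4 : (len (y^-1 * x)%g)%:R / n%:R = (len x)%:R / n%:R - 1 :> R.
    by rewrite lyx natrB // mulrBl mulfV ?gt_eqF.
  have g0 : gromov_product W y 1%g x = 0.
    by rewrite /gromov_product !word_dist1 ly /word_dist lyx natrB //; lra.
  have := hl y 1%g x; rewrite g0 mulr0 add0r ler_norml /gromov_product.
  by move=> /andP[_]; lra.
exists n%:R^-1, (B + 1); split; first by rewrite invr_gt0.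
move=> x y; rewrite /word_dist -(pL x^-1%g) mulVg mulrC.
exact: (key (len (x^-1 * y)%g)).
Qed.

End Spectrum.

Section LimitInequality.
Context {R : realType} {G : groupType}.

Lemma translation_length_combination_ge0 (d1 d2 : G -> G -> R) (t s B : R) x :
  is_pseudo_metric d1 -> left_invariant d1 ->
  is_pseudo_metric d2 -> left_invariant d2 ->
  (forall y, - B <= t * d1 1%g y + s * d2 1%g y) ->
  0 <= t * translation_length d1 x + s * translation_length d2 x.
Proof.
move=> d1P d1L d2P d2L hB.
have [_ h1 _] := translation_length_exists d1P d1L x.
have [_ h2 _] := translation_length_exists d2P d2L x.
have h3 : (fun n : nat => t * (n%:R^-1 * d1 1%g (x ^+ n)%g)
     + s * (n%:R^-1 * d2 1%g (x ^+ n)%g)) @ \oo -->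
   (t * translation_length d1 x + s * translation_length d2 x).
  by apply: cvgD; apply: cvgM => //; exact: cvg_cst.
rewrite -(cvg_lim (@Rhausdorff R) h3).
apply/ler_addgt0Pr => e e0; rewrite -lerBlDr sub0r.
apply: limr_ge; first by apply/cvg_ex; eexists; exact: h3.
near=> n.
have n0 : (0 < n)%N by near: n; exact: nbhs_infty_gt.
have nR : 0 < n%:R :> R by rewrite ltr0n.
have nB : B / e <= n%:R by near: n; exact: nbhs_infty_ger.
rewrite (mulrCA t) (mulrCA s) -mulrDr ler_pdivlMl //.
apply: le_trans (hB _); rewrite mulrN lerN2.
by move: nB; rewrite ler_pdivrMr.
Unshelve. all: by end_near. Qed.

End LimitInequality.

(** * One-variable estimates *)

Section CrossRatio.
Context {R : realType}.
Implicit Types (t x p q : R).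

(** The quotient depends only on the ray of [(t, x)], and increases as the ray turns
towards the first axis. *)
Lemma ln_quotient_lt p q t t' x x' : p < q ->
  0 < t * p + x -> 0 < t' * p + x' -> 0 < t * q + x -> 0 < t' * q + x' ->
  t * x' < t' * x ->
  ln ((t * q + x) / (t * p + x)) < ln ((t' * q + x') / (t' * p + x')).
Proof.
move=> pq a1 b1 a2 b2 key.
rewrite ltr_ln ?posrE ?divr_gt0 // ltr_pdivrMr // mulrAC ltr_pdivlMr // -subr_gt0.
have -> : (t' * q + x') * (t * p + x) - (t * q + x) * (t' * p + x') =
    (q - p) * (t' * x - t * x') by nra.
by rewrite mulr_gt0 // subr_gt0.
Qed.

Lemma ray_order_pos t t' x x' : 0 < t -> x' < t' / t * x -> t * x' < t' * x.
Proof. by move=> t0; rewrite mulrAC ltr_pdivlMr // mulrC. Qed.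

Lemma ray_order_neg t t' x x' : t' < 0 -> x < t / t' * x' -> t * x' < t' * x.
Proof. by move=> t0; rewrite mulrAC ltr_ndivlMr // (mulrC x). Qed.

Lemma increasing_inverse (u : R -> R) :
  {homo u : r r' / r < r'} -> (forall v, exists t, u t = v) ->
  exists phi : R -> R, [/\ cancel u phi, cancel phi u, {homo phi : r r' / r < r'}
    & set_bij [set: R] [set: R] phi].
Proof.
move=> mono surj; have /choice[phi phiK] := surj.
have inj : injective u.
  move=> t t' e; have [lt|lt|//] := ltgtP t t'; have := mono _ _ lt;
  by rewrite e ltxx.
have uK t : phi (u t) = t by apply: inj; rewrite phiK.
exists phi; split => //.
- move=> x y xy; rewrite ltNge; apply/negP; rewrite le_eqVlt => /orP[/eqP e|/mono].
    by move: xy; rewrite -(phiK x) -(phiK y) e ltxx.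
  by rewrite !phiK ltNge ltW.
- split => //; first by move=> x y _ _ e; rewrite -(phiK x) -(phiK y) e.
  by move=> t _; exists (u t).
Qed.

End CrossRatio.

(** * Linear combinations of two metrics *)

Section Pencil.
Context {R : realType} {G : groupType}.
Variables (S : set G) (len : G -> nat) (delta : R).
Hypotheses (hS : finite_symmetric_generating S) (hlen : is_word_length len).
Local Notation W := (@word_dist G R len).
Hypotheses (SW : forall x y, word_metric S x y = W x y).
Hypotheses (delta0 : 0 <= delta) (WH : four_point W delta).
Variables (h : G).
Hypotheses (h_inf : forall n, (0 < n)%N -> (h ^+ n <> 1)%g).
Hypothesis hne : ~ virtually_cyclic G.

Let WP : is_pseudo_metric W := word_dist_pseudo_metric hlen.
Local Notation tl := translation_length.

Lemma metricsD_pm (d : G -> G -> R) : metricsD d -> is_pseudo_metric d /\ left_invariant d.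
Proof. by case. Qed.

Lemma metricsD_compare (d d1 : G -> G -> R) : metricsD d ->
  is_pseudo_metric d1 -> left_invariant d1 ->
  exists2 K : R, 0 < K & forall x y, d1 x y <= K * d x y + K.
Proof.
move=> dD d1P d1L; have [eps [B [eps0 B0 hB]]] := metricsD_coercive hlen dD.
have [A A0 hA] := len_lipschitz hlen d1P d1L.
have e0 : 0 <= eps^-1 by rewrite invr_ge0 ltW.
have [d0 _ _ _] := (metricsD_pm dD).1.
exists (A * eps^-1 + A * eps^-1 * B + 1).
  apply: ltr_pwDr; first exact: ltr01.
  by apply: addr_ge0; rewrite !mulr_ge0.
move=> x y; have W1 : W x y <= eps^-1 * (d x y + B).
  by rewrite ler_pdivlMl //; have := hB x y; lra.
apply: le_trans (hA x y) _; apply: le_trans (ler_wpM2l A0 W1) _.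
have h1 : 0 <= A * eps^-1 by exact: mulr_ge0.
have h2 : 0 <= A * eps^-1 * B by exact: mulr_ge0.
have h3 := mulr_ge0 h2 (d0 x y).
have h4 := d0 x y.
by rewrite mulrA mulrDr !mulrDl mul1r; lra.
Qed.

Lemma translation_length_le_metric (d d1 : G -> G -> R) (K B : R) :
  is_pseudo_metric d -> left_invariant d ->
  is_pseudo_metric d1 -> left_invariant d1 ->
  (forall x y, d1 x y <= K * d x y + B) -> forall g, tl d1 g <= K * tl d g.
Proof.
move=> dP dL d1P d1L hK g.
have := @translation_length_combination_ge0 R G d1 d (-1) K B g d1P d1L dP dL.
have h1 : forall y, - B <= -1 * d1 1%g y + K * d 1%g y by move=> y; have := hK 1%g y; lra.
by move=> /(_ h1); lra.
Qed.

Lemma metricsD_loxodromic (d : G -> G -> R) : metricsD d -> exists g, 0 < tl d g.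
Proof.
move=> dD; have [dP dL] := metricsD_pm dD.
have [phi /(_ d dP dL (metricsD_dominated hlen delta0 WH dD))[C hC]] :=
  spectrum_determines hlen delta0 WH h_inf hne.
have [eps [B [eps0 B0 hB]]] := metricsD_coercive hlen dD.
have [x lx] := long_element h_inf hlen (Num.truncn (eps^-1 * (C + B))).+1.
exists (phi x); have := hC x; rewrite ler_norml => /andP[+ _].
have := hB 1%g x; rewrite word_dist1.
have : C + B < eps * (len x)%:R.
  rewrite mulrC -ltr_pdivrMr // mulrC.
  by apply: lt_le_trans (truncnS_gt _) _; rewrite ler_nat.
by lra.
Qed.

Lemma tl_non_torsion (d : G -> G -> R) g : is_pseudo_metric d -> left_invariant d ->
  tl d g != 0 -> non_torsion g.
Proof.
move=> dP dL /eqP g0 n n0 gn; apply: g0.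
exact: (translation_length_torsion dP dL n0 gn).
Qed.

Lemma roughly_similar_refl (f : G -> G -> R) : roughly_similar f f.
Proof. by exists 1, 1; split => // x y; rewrite mul1r subrr normr0 ler01. Qed.

Lemma roughly_similar_sym (f g : G -> G -> R) :
  roughly_similar f g -> roughly_similar g f.
Proof.
move=> [tau [C [tau0 C0 hC]]]; exists tau^-1, (tau^-1 * C).
split; rewrite ?mulr_gt0 ?invr_gt0 // => x y.
have -> : tau^-1 * g x y - f x y = - (tau^-1 * (tau * f x y - g x y)).
  by rewrite mulrBr mulKf ?gt_eqF // opprB.
rewrite normrN normrM gtr0_norm ?invr_gt0 // ler_pM2l ?invr_gt0 //.
Qed.

Lemma roughly_similar_trans (f g k : G -> G -> R) :
  roughly_similar f g -> roughly_similar g k -> roughly_similar f k.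
Proof.
move=> [tau [C [tau0 C0 hC]]] [tau' [C' [tau0' C0' hC']]].
exists (tau' * tau), (tau' * C + C'); split; first exact: mulr_gt0.
  by rewrite addr_gt0 // mulr_gt0.
move=> x y.
have -> : tau' * tau * f x y - k x y =
    tau' * (tau * f x y - g x y) + (tau' * g x y - k x y).
  by rewrite mulrBr mulrA; lra.
apply: le_trans (ler_normD _ _) _; apply: lerD => //.
by rewrite normrM gtr0_norm // ler_pM2l.
Qed.

Lemma rough_class_eq (A : set (G -> G -> R)) f g :
  roughly_similar f g -> rough_class A f = rough_class A g.
Proof.
move=> fg; apply/seteqP; split => k [Ak hk]; split => //.
  exact: roughly_similar_trans (roughly_similar_sym fg) hk.
exact: roughly_similar_trans fg hk.
Qed.

Lemma rough_class_self (A : set (G -> G -> R)) f : A f -> rough_class A f f.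
Proof. by move=> Af; split => //; exact: roughly_similar_refl. Qed.

(** An element with vanishing translation length contributes the ratio 0, by the
convention on division, which does not change a supremum of nonnegative ratios.
So [dil d1 d2] is the least D with [tl d1 g <= D * tl d2 g] for all [g]. *)

Section Dilation.
Variables (d1 d2 : G -> G -> R) (d1D : metricsD d1) (d2D : metricsD d2).

Let d1P := (metricsD_pm d1D).1. Let d1L := (metricsD_pm d1D).2.
Let d2P := (metricsD_pm d2D).1. Let d2L := (metricsD_pm d2D).2.

Let X := [set tl d1 x / tl d2 x | x in non_torsion].

Lemma ratio_le D g : 0 <= D -> (forall g, tl d1 g <= D * tl d2 g) -> tl d1 g / tl d2 g <= D.
Proof.
move=> D0 hD; have := translation_length_ge0 d2P d2L g.
rewrite le_eqVlt => /orP[/eqP <-|t0]; first by rewrite invr0 mulr0.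
by rewrite ler_pdivrMr.
Qed.

Lemma dil_has_sup : has_sup X.
Proof.
split.
  have [g g0] := metricsD_loxodromic d1D; exists (tl d1 g / tl d2 g), g => //.
  by apply: (tl_non_torsion d1P d1L); rewrite gt_eqF.
have [K K0 hK] := metricsD_compare d2D d1P d1L.
exists K => _ [g _ <-]; apply: ratio_le; first exact: ltW.
exact: (translation_length_le_metric d2P d2L d1P d1L hK).
Qed.

Lemma dil_le D : 0 <= D -> (forall g, tl d1 g <= D * tl d2 g) -> dil d1 d2 <= D.
Proof.
move=> D0 hD; apply: ge_sup; first by case: dil_has_sup.
by move=> _ [g _ <-]; exact: ratio_le.
Qed.

Lemma dil_ratio g : non_torsion g -> tl d1 g / tl d2 g <= dil d1 d2.
Proof. by move=> gn; apply: ub_le_sup; [case: dil_has_sup|exists g]. Qed.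

Lemma dil_ub g : tl d1 g <= dil d1 d2 * tl d2 g.
Proof.
have [K K0 hK] := metricsD_compare d2D d1P d1L.
have h1 := translation_length_le_metric d2P d2L d1P d1L hK g.
have := translation_length_ge0 d2P d2L g.
rewrite le_eqVlt => /orP[/eqP e|t0]; first by move: h1; rewrite -e !mulr0.
rewrite -ler_pdivrMr //; apply: dil_ratio.
by apply: (tl_non_torsion d2P d2L); rewrite gt_eqF.
Qed.

Lemma dil_gt0 : 0 < dil d1 d2.
Proof.
have [g g0] := metricsD_loxodromic d1D.
have := lt_le_trans g0 (dil_ub g); have := translation_length_ge0 d2P d2L g.
rewrite le_eqVlt => /orP[/eqP <-|t0]; first by rewrite mulr0 ltxx.
by rewrite pmulr_lgt0.
Qed.

End Dilation.

Section Cone.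
Variables (ds d : G -> G -> R) (dsD : metricsD ds) (dD : metricsD d).
Implicit Types (t s : R).

Let dsP := (metricsD_pm dsD).1. Let dsL := (metricsD_pm dsD).2.
Let dP := (metricsD_pm dD).1. Let dL := (metricsD_pm dD).2.
Let ds_dom := metricsD_dominated hlen delta0 WH dsD.
Let d_dom := metricsD_dominated hlen delta0 WH dD.

Definition comb t s (x y : G) : R := t * ds x y + s * d x y.

(** The extreme values of the ratio of the translation lengths of [ds] and [d]. *)
Definition ratio_inf : R := (dil d ds)^-1.
Definition ratio_sup : R := dil ds d.

(** A linear form in the two translation lengths is positive when it is positive at
both extreme ratios. *)
Definition in_cone t s : Prop := 0 < t * ratio_inf + s /\ 0 < t * ratio_sup + s.

Lemma comb_dominated t s : dominated len (comb t s).
Proof. exact: (dominated_lin t s ds_dom d_dom). Qed.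

(** The elements [phi x] turn a statement on translation lengths into one on
displacements. *)
Lemma comb_bounded_below t s : (forall g, 0 <= t * tl ds g + s * tl d g) ->
  exists B : R, forall x y, - B <= comb t s x y.
Proof.
move=> hg; have [phi hphi] := spectrum_determines hlen delta0 WH h_inf hne.
have [C1 h1] := hphi ds dsP dsL ds_dom; have [C2 h2] := hphi d dP dL d_dom.
exists (`|t| * C1 + `|s| * C2) => x y.
have [cL _ _ _] := comb_dominated t s.
rewrite -(cL x^-1%g) mulVg; set z := (x^-1 * y)%g.
have := hg (phi z); rewrite /comb.
have := ler_wpM2l (normr_ge0 t) (h1 z); rewrite -normrM ler_norml => /andP[_].
have := ler_wpM2l (normr_ge0 s) (h2 z); rewrite -normrM ler_norml => /andP[_].
by rewrite !mulrBr; lra.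
Qed.

Lemma ratio_inf_gt0 : 0 < ratio_inf.
Proof. by rewrite invr_gt0 dil_gt0. Qed.

Lemma ratio_inf_tl g : ratio_inf * tl d g <= tl ds g.
Proof. by rewrite ler_pdivrMl ?dil_gt0 // dil_ub. Qed.

Lemma ratio_sup_tl g : tl ds g <= ratio_sup * tl d g.
Proof. exact: dil_ub. Qed.

Lemma ratio_inf_le_sup : ratio_inf <= ratio_sup.
Proof.
have [g g0] := metricsD_loxodromic dD.
by have := le_trans (ratio_inf_tl g) (ratio_sup_tl g); rewrite ler_pM2r.
Qed.

Lemma closed_cone_spectrum t s : 0 <= t * ratio_inf + s -> 0 <= t * ratio_sup + s ->
  forall g, 0 <= t * tl ds g + s * tl d g.
Proof.
move=> h1 h2 g; have g0 := translation_length_ge0 dP dL g.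
have [t0|/ltW t0] := leP 0 t.
  have := mulr_ge0 h1 g0; have := ler_wpM2l t0 (ratio_inf_tl g).
  by rewrite mulrDl mulrA; lra.
have := mulr_ge0 h2 g0; have := ler_wnM2l t0 (ratio_sup_tl g).
by rewrite mulrDl mulrA; lra.
Qed.

(** Minimality of the two dilations: a nonnegative form with one negative coefficient
is an inequality between translation lengths. *)
Lemma spectrum_closed_cone t s : (forall g, 0 <= t * tl ds g + s * tl d g) ->
  0 <= t * ratio_inf + s /\ 0 <= t * ratio_sup + s.
Proof.
move=> hg; have [g g0] := metricsD_loxodromic dD.
have gs0 : 0 < tl ds g by apply: lt_le_trans (ratio_inf_tl g); rewrite mulr_gt0 ?ratio_inf_gt0.
have lh := ratio_inf_le_sup; have l0 := ratio_inf_gt0.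
have [t0|t0] := leP 0 t.
  suff h1 : 0 <= t * ratio_inf + s by split => //; have := ler_wpM2l t0 lh; lra.
  have [s0|s0] := leP 0 s; first by rewrite addr_ge0 // mulr_ge0 // ltW.
  have tp : 0 < t.
    rewrite lt_neqAle t0 andbT; apply/eqP => te; have := hg g.
    by rewrite -te mul0r add0r => /(le_lt_trans)/(_ _); have := pmulr_llt0 s g0; rewrite s0; move=> h1 /(_ 0); rewrite h1 ltxx => /(_ isT).
  have sp : 0 < - s by rewrite oppr_gt0.
  have : dil d ds <= t / - s.
    apply: dil_le => //; first by rewrite divr_ge0 // ltW.
    by move=> g'; rewrite mulrAC ler_pdivlMr //; have := hg g'; lra.
  have dp := dil_gt0 dD dsD.
  rewrite ler_pdivlMr // -ler_pdivlMl // => h1.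
  by rewrite /ratio_inf (mulrC t); lra.
suff h1 : 0 <= t * ratio_sup + s by split => //; have := ler_wnM2l (ltW t0) lh; lra.
have tp : 0 < - t by rewrite oppr_gt0.
have s0 : 0 <= s.
  rewrite leNgt; apply/negP => s0; have := hg g.
  have : t * tl ds g < 0 by rewrite pmulr_llt0.
  have : s * tl d g < 0 by rewrite pmulr_llt0.
  by lra.
have : dil ds d <= s / - t.
  apply: dil_le => //; first by rewrite divr_ge0 // ltW.
  by move=> g'; rewrite mulrAC ler_pdivlMr //; have := hg g'; lra.
by rewrite ler_pdivlMr // -/ratio_sup; lra.
Qed.

Lemma cone_coercive t s : in_cone t s -> exists eps B : R, 0 < eps /\
  forall x y, eps * W x y - B <= comb t s x y.
Proof.
move=> [h1 h2]; pose e := Num.min (t * ratio_inf + s) (t * ratio_sup + s).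
have e0 : 0 < e by rewrite lt_min h1.
have e1 : e <= t * ratio_inf + s by rewrite ge_min lexx.
have e2 : e <= t * ratio_sup + s by rewrite ge_min lexx orbT.
have [|B hB] := @comb_bounded_below t (s - e).
  by apply: closed_cone_spectrum; lra.
have [eps [B' [eps0 B0 hB']]] := metricsD_coercive hlen dD.
exists (e * eps), (B + e * B'); split; first exact: mulr_gt0.
move=> x y; have := hB x y; rewrite /comb.
have := ler_wpM2l (ltW e0) (hB' x y); rewrite mulrBr mulrA mulrBl; lra.
Qed.

Lemma coercive_cone t s eps B : 0 < eps ->
  (forall x y, eps * W x y - B <= comb t s x y) -> in_cone t s.
Proof.
move=> eps0 hB; have [A A0 hA] := len_lipschitz hlen dP dL.
have A1 : 0 < A + 1 by lra.
pose e := eps / (A + 1).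
have e0 : 0 < e by exact: divr_gt0.
have [|h1 h2] := @spectrum_closed_cone t (s - e); last by split; lra.
move=> g; apply: (translation_length_combination_ge0 (B := B)) => // y.
have := hB 1%g y; rewrite /comb.
have : e * d 1%g y <= eps * W 1%g y.
  rewrite /e mulrAC ler_pdivrMr // -mulrA ler_pM2l //.
  apply: le_trans (hA _ _) _; rewrite mulrDr mulr1 mulrC lerDl.
  by case: WP.
rewrite mulrBl; lra.
Qed.

Lemma in_coneZ t s a : 0 < a -> in_cone t s -> in_cone (a * t) (a * s).
Proof. by move=> a0 [h1 h2]; split; rewrite -mulrA -mulrDr mulr_gt0. Qed.

Lemma in_coneD t s t' s' : in_cone t s -> in_cone t' s' -> in_cone (t + t') (s + s').
Proof.
move=> [h1 h2] [h3 h4]; split; rewrite mulrDl; lra.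
Qed.

Definition summable_at t s : Prop := exp_summable (comb t s 1%g).

Lemma comb_upper t s : exists2 A : R, 0 < A & forall x y, comb t s x y <= A * W x y.
Proof.
have [A A0 hA] := len_lipschitz hlen dP dL.
have [As As0 hAs] := len_lipschitz hlen dsP dsL.
exists (`|t| * As + `|s| * A + 1).
  by rewrite ltr_pwDr ?ltr01 // addr_ge0 // mulr_ge0.
move=> x y; rewrite /comb.
have [d0 _ _ _] := dP; have [ds0 _ _ _] := dsP.
have := ler_wpM2l (normr_ge0 t) (hAs x y).
have := ler_wpM2l (normr_ge0 s) (hA x y).
have := ler_wpM2r (d0 x y) (ler_norm s).
have := ler_wpM2r (ds0 x y) (ler_norm t).
have : 0 <= W x y by case: WP.
by rewrite !mulrDl mul1r !mulrA; lra.
Qed.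

Lemma summable_mono t s s' : s <= s' -> summable_at t s -> summable_at t s'.
Proof.
move=> ss'; apply: (@exp_summable_le _ _ _ _ 0) => x; rewrite addr0 lerD2l.
by apply: ler_wpM2r => //; case: dP.
Qed.

Lemma summable_scale t s a a' : in_cone t s -> a <= a' ->
  summable_at (a * t) (a * s) -> summable_at (a' * t) (a' * s).
Proof.
move=> /cone_coercive[eps [B [eps0 hB]]] aa'.
apply: (@exp_summable_le _ _ _ _ ((a' - a) * `|B|)) => x; rewrite /comb.
have B1 : - `|B| <= t * ds 1%g x + s * d 1%g x.
  apply: le_trans (hB 1%g x); have := ler_norm B.
  have : 0 <= eps * W 1%g x by apply: mulr_ge0; [exact: ltW|case: WP].
  by lra.
have aa0 : 0 <= a' - a by lra.
have := ler_wpM2l aa0 B1; rewrite mulrN !mulrBl !mulrDr !mulrA; lra.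
Qed.

Lemma cone_summable t s : in_cone t s -> exists2 a : R, 0 < a & summable_at (a * t) (a * s).
Proof.
move=> /cone_coercive[eps [B [eps0 hB]]].
have [b b0 hb] := exp_summable_len (R := R) hlen.
exists (b / eps); first exact: divr_gt0.
apply: exp_summable_le hb => x.
instantiate (1 := b / eps * B).
have := ler_wpM2l (ltW (divr_gt0 b0 eps0)) (hB 1%g x).
by rewrite word_dist1 /comb mulrBr mulrA divfK ?gt_eqF // mulrDr !mulrA; lra.
Qed.

(** A combination on the boundary of the cone is bounded below without being coercive,
so it takes bounded values at arbitrarily long elements. *)
Lemma boundary_not_summable t s : 0 <= t * ratio_inf + s -> 0 <= t * ratio_sup + s ->
  ~ in_cone t s -> exists2 eps : R, 0 < eps & ~ summable_at t (s + eps).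
Proof.
move=> h1 h2 nc; have [B hB] := comb_bounded_below (closed_cone_spectrum h1 h2).
have cD := comb_dominated t s.
have [[eps [B' [eps0 hB']]]|[C1 hC1]] := degenerate_or_coercive hlen cD hB.
  by case: nc; exact: (coercive_cone eps0 hB').
have [eps eps0 he] := degenerate_divergence hlen delta0 WH h_inf hne cD dP dL hB hC1.
exists eps => //; apply: not_exp_summable => b; have [l ul hl] := he b.
exists l => //; apply: lt_le_trans hl _; apply: ler_sum => x _.
by rewrite /comb mulrDl addrA.
Qed.

Local Notation theta := (manhattan_theta ds d).

Lemma thetaE t : theta t = inf [set s | summable_at t s].
Proof.
rewrite /manhattan_theta; congr inf; apply/seteqP; split => s /=.
  move=> hs; apply/exp_summable_esum; congr (_ < _)%E: hs.
  by apply: eq_esum => x _; rewrite /comb; congr ((expR _)%:E); lra.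
move=> /exp_summable_esum hs; congr (_ < _)%E: hs.
by apply: eq_esum => x _; rewrite /comb; congr ((expR _)%:E); lra.
Qed.

Lemma boundary_point t : exists s, [/\ 0 <= t * ratio_inf + s, 0 <= t * ratio_sup + s,
  ~ in_cone t s & forall s', s < s' -> in_cone t s'].
Proof.
exists (Num.max (- (t * ratio_inf)) (- (t * ratio_sup))); split.
- by rewrite -lerBlDl sub0r le_max lexx.
- by rewrite -lerBlDl sub0r le_max lexx orbT.
- by case: (leP (- (t * ratio_inf)) (- (t * ratio_sup))) => hh [h1 h2]; lra.
- by move=> s'; rewrite gt_max => /andP[? ?]; split; lra.
Qed.

(** Divergence slightly above the boundary of the cone keeps the infimum defining
[theta] strictly inside the cone. *)
Lemma theta_inf t : [/\ has_inf [set s | summable_at t s], in_cone t (theta t),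
  forall s, theta t < s -> summable_at t s & forall s, s < theta t -> ~ summable_at t s].
Proof.
have [s0 [h1 h2 h3 h4]] := boundary_point t.
have [eps eps0 he] := boundary_not_summable h1 h2 h3.
have lbS : lbound [set s | summable_at t s] (s0 + eps).
  move=> s hs; rewrite leNgt; apply/negP => /ltW ss; apply: he.
  exact: summable_mono ss hs.
have hinf : has_inf [set s | summable_at t s].
  split; last by exists (s0 + eps).
  have [b b0 hb] := exp_summable_len (R := R) hlen.
  have [e [B [e0 B0 hB]]] := metricsD_coercive hlen dD.
  have [A A0 hA] := comb_upper (- t) 0.
  exists ((A + b) / e); apply: exp_summable_le hb => x.
  instantiate (1 := (A + b) / e * B).
  have Ab : 0 < (A + b) / e by rewrite divr_gt0 // addr_gt0.
  have := ler_wpM2l (ltW Ab) (hB 1%g x).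
  have := hA 1%g x; rewrite /comb mul0r addr0 mulrBr mulrA divfK ?gt_eqF //.
  by rewrite word_dist1 mulrDl; lra.
have th : s0 + eps <= theta t by rewrite thetaE; apply: lb_le_inf => //; case: hinf.
split => //.
- by apply: h4; lra.
- move=> s; rewrite thetaE -subr_gt0 => ss.
  have [s' hs' hs] := inf_adherent ss hinf.
  by apply: summable_mono hs'; lra.
- move=> s + hs; rewrite thetaE ltNge => /negP; apply.
  by apply: ge_inf => //; case: hinf.
Qed.

Lemma theta_cone t : in_cone t (theta t).
Proof. by case: (theta_inf t). Qed.

Lemma theta_le t s : summable_at t s -> theta t <= s.
Proof.
have [_ _ _ h4] := theta_inf t.
by move=> hs; rewrite leNgt; apply/negP => /h4.
Qed.

Lemma theta_ge t s : ~ summable_at t s -> s <= theta t.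
Proof.
have [_ _ h3 _] := theta_inf t.
by move=> hs; rewrite leNgt; apply/negP => /h3.
Qed.

Lemma theta0_gt0 : 0 < theta 0.
Proof. by have [+ _] := theta_cone 0; rewrite mul0r add0r. Qed.

(** Combinations in the cone and elements of D are comparable up to constants. *)
Lemma cone_absorbs t s c : in_cone t s -> 0 < c ->
  exists2 e : R, 0 < e & exists B : R, forall x : G,
    e * d 1%g x <= c * comb t s 1%g x + B.
Proof.
move=> tsc c0; have [eps [B [eps0 hB]]] := cone_coercive tsc.
have [A A0 hA] := comb_upper 0 1.
exists (c * eps / A); first by rewrite divr_gt0 // mulr_gt0.
exists (c * B) => x; have := ler_wpM2l (ltW c0) (hB 1%g x).
rewrite mulrBr mulrA => h1.
apply: le_trans (_ : c * eps * W 1%g x <= _); last by lra.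
rewrite mulrAC ler_pdivrMr // -[leRHS]mulrA ler_wpM2l //.
  by apply: mulr_ge0; exact: ltW.
by have := hA 1%g x; rewrite /comb mul0r add0r mul1r mulrC.
Qed.

(** Increasing the scale along a ray of the cone leaves room for a small decrease of
the second coordinate. *)
Lemma summable_ray t s a a' : in_cone t s -> a < a' ->
  summable_at (a * t) (a * s) ->
  exists2 e : R, 0 < e & summable_at (a' * t) (a' * s - e).
Proof.
move=> tsc; rewrite -subr_gt0 => aa' hs; have [e e0 [B hB]] := cone_absorbs tsc aa'.
exists e => //; apply: (exp_summable_le (B := B)) hs => x; have := hB x.
by rewrite /comb !mulrBl !mulrDr !mulrA; lra.
Qed.

(** The critical exponent of [comb t (theta t)] is 1, so its larger multiples lie
strictly above the graph of [theta]. *)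
Lemma theta_scale t a : 1 < a -> theta (a * t) < a * theta t.
Proof.
move=> a1; have [_ c1 h3 _] := theta_inf t.
pose b := (1 + a) / 2.
have b1 : 0 < b - 1 by rewrite /b; lra.
have ba : b < a by rewrite /b; lra.
have sb : summable_at (b * t) (b * theta t).
  have [e e0 [B hB]] := cone_absorbs c1 b1.
  have := h3 (theta t + e); rewrite ltrDl => /(_ e0).
  apply: (exp_summable_le (B := B)) => x; have := hB x.
  by rewrite /comb !mulrBl !mul1r !mulrDl !mulrDr !mulrA; lra.
have [e e0 /theta_le] := summable_ray c1 ba sb.
by move=> /le_lt_trans; apply; rewrite ltrBlDr ltrDl.
Qed.

(** The multiple of [(t, s)] with critical exponent 1 lies on the graph of [theta]. *)
Lemma theta_ray t s : in_cone t s -> exists2 a : R, 0 < a & theta (a * t) = a * s.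
Proof.
move=> tsc; pose X := [set a | summable_at (a * t) (a * s)].
have X0 : lbound X 0.
  move=> a Xa; rewrite leNgt; apply/negP => a0.
  have p1 (r : R) : 0 <= 0 * r + 0 :> R by rewrite mul0r addr0.
  have [|eps eps0 he] := boundary_not_summable (p1 ratio_inf) (p1 ratio_sup).
    by case; rewrite mul0r addr0 ltxx.
  apply: he; apply: (@summable_mono _ 0); first by rewrite add0r ltW.
  by have := summable_scale tsc (ltW a0) Xa; rewrite !mul0r.
have hX : has_inf X.
  by split; [have [a _ ha] := cone_summable tsc; exists a|exists 0].
pose a := inf X.
have a0 : 0 <= a by apply: lb_le_inf => //; case: hX.
have Xgt b : a < b -> X b.
  rewrite -subr_gt0 => ab; have [c Xc cb] := inf_adherent ab hX.
  by apply: summable_scale tsc _ Xc; rewrite -/a in cb; lra.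
have Xlt b : b < a -> ~ X b.
  move=> ba Xb; move: ba; rewrite ltNge => /negP; apply.
  by apply: ge_inf => //; case: hX.
have transfer e : 0 < e -> exists c, 0 < c /\ exists B, forall x : G,
    c * comb t s 1%g x <= e * d 1%g x + B.
  move=> e0; have [A A0 hA] := comb_upper t s.
  have [eps [B [eps0 B0 hB]]] := metricsD_coercive hlen dD.
  exists (e * eps / A); split; first by rewrite divr_gt0 // mulr_gt0.
  exists (e * B) => x; have h1 := ler_wpM2l (ltW e0) (hB 1%g x).
  apply: le_trans (_ : e * eps * W 1%g x <= _); last first.
    by move: h1; rewrite mulrBr mulrA; lra.
  rewrite mulrAC ler_pdivrMr // -[leRHS]mulrA ler_wpM2l //.
    by apply: mulr_ge0; exact: ltW.
  by rewrite mulrC.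
have ath : theta (a * t) = a * s.
  apply/eqP; rewrite eq_le; apply/andP; split.
    apply/ler_addgt0Pr => e e0; apply: theta_le.
    have [c [c0 [B hc]]] := transfer e e0.
    have ac : X (a + c) by apply: Xgt; rewrite ltrDl.
    apply: (exp_summable_le (B := B)) ac => x; have := hc x.
    by rewrite /comb !mulrDl !mulrDr !mulrA; lra.
  apply/ler_addgt0Pr => e e0; rewrite -lerBlDr; apply: theta_ge => hs.
  have [c [c0 [B hc]]] := transfer e e0.
  apply: (Xlt (a - c)); first by rewrite ltrBlDr ltrDl.
  apply: (exp_summable_le (B := B)) hs => x; have := hc x.
  by rewrite /comb !mulrBl !mulrDr !mulrA; lra.
exists a => //; rewrite lt_neqAle a0 andbT eq_sym; apply/eqP => ae.
by have := theta0_gt0; move: ath; rewrite ae !mul0r => ->; rewrite ltxx.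
Qed.

Lemma comb_translation_length a t s g : metricsD a ->
  bounded_distance a (comb t s) -> tl a g = t * tl ds g + s * tl d g.
Proof.
move=> /metricsD_pm[aP aL] [C hC].
by apply: (translation_length_combination (C := C)) => // y; exact: hC.
Qed.

Lemma near_in_cone a t s : metricsD a -> bounded_distance a (comb t s) -> in_cone t s.
Proof.
move=> aD [C hC]; have [eps [B [eps0 B0 hB]]] := metricsD_coercive hlen aD.
apply: (@coercive_cone t s eps (B + C)) => // x y.
by have := hB x y; have := hC x y; rewrite ler_norml => /andP[_]; lra.
Qed.

(** The inequality [tl a g <= D * tl b g] says that the combination with coefficients
[D * t' - t] and [D * s' - s] belongs to the closed cone. *)
Lemma dil_comb a b t s t' s' : metricsD a -> metricsD b ->
  bounded_distance a (comb t s) -> bounded_distance b (comb t' s') ->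
  dil a b = Num.max ((t * ratio_inf + s) / (t' * ratio_inf + s')) ((t * ratio_sup + s) / (t' * ratio_sup + s')).
Proof.
move=> aD bD ha hb.
have [a1 a2] := near_in_cone aD ha; have [b1 b2] := near_in_cone bD hb.
have tla g := comb_translation_length g aD ha.
have tlb g := comb_translation_length g bD hb.
set D := Num.max _ _.
have D1 : (t * ratio_inf + s) / (t' * ratio_inf + s') <= D by rewrite le_max lexx.
have D2 : (t * ratio_sup + s) / (t' * ratio_sup + s') <= D by rewrite le_max lexx orbT.
have D0 : 0 <= D by apply: le_trans D1; rewrite divr_ge0 // ltW.
apply/eqP; rewrite eq_le; apply/andP; split.
  apply: dil_le => // g; rewrite tla tlb -subr_ge0.
  rewrite ler_pdivrMr // mulrDr mulrA in D1.
  rewrite ler_pdivrMr // mulrDr mulrA in D2.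
  have : 0 <= (D * t' - t) * tl ds g + (D * s' - s) * tl d g.
    by apply: closed_cone_spectrum; rewrite mulrBl; lra.
  by rewrite !mulrBl mulrDr !mulrA; lra.
have [|h1 h2] := @spectrum_closed_cone (dil a b * t' - t) (dil a b * s' - s).
  move=> g; have := dil_ub aD bD g; rewrite tla tlb.
  rewrite mulrDr !mulrBl !mulrA; lra.
move: h1 h2; rewrite !mulrBl => h1 h2.
by rewrite ge_max !ler_pdivrMr // !mulrDr !mulrA; apply/andP; split; lra.
Qed.

(** Differences of this coordinate are the Hilbert metric of the cone, that is the
logarithm of the cross-ratio of two rays with the two boundary rays. *)
Definition hilbert_coord t s : R := ln ((t * ratio_sup + s) / (t * ratio_inf + s)).

Lemma hilbert_coordZ t s a : 0 < a -> hilbert_coord (a * t) (a * s) = hilbert_coord t s.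
Proof.
by move=> a0; rewrite /hilbert_coord -!mulrA -!mulrDr -mulf_div divff ?mul1r // gt_eqF.
Qed.

Lemma dil_product a b t s t' s' : metricsD a -> metricsD b ->
  bounded_distance a (comb t s) -> bounded_distance b (comb t' s') ->
  ln (dil a b * dil b a) = `|hilbert_coord t s - hilbert_coord t' s'|.
Proof.
move=> aD bD ha hb.
have [a1 a2] := near_in_cone aD ha; have [b1 b2] := near_in_cone bD hb.
rewrite (dil_comb aD bD ha hb) (dil_comb bD aD hb ha) /hilbert_coord.
move: (t * ratio_inf + s) (t * ratio_sup + s) (t' * ratio_inf + s') (t' * ratio_sup + s') a1 a2 b1 b2.
move=> p q p' q' p0 q0 p0' q0'.
have e1 : p' / p = (p / p')^-1 by rewrite invfM invrK mulrC.
have e2 : q' / q = (q / q')^-1 by rewrite invfM invrK mulrC.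
have x0 : 0 < p / p' by exact: divr_gt0.
have y0 : 0 < q / q' by exact: divr_gt0.
rewrite e1 e2 !ln_div ?posrE // ?divr_gt0 //.
have lx : ln (p / p') = ln p - ln p' by rewrite ln_div ?posrE.
have ly : ln (q / q') = ln q - ln q' by rewrite ln_div ?posrE.
move: lx ly; move: (p / p') (q / q') x0 y0 => x y x0 y0 lx ly.
have -> : ln q - ln p - (ln q' - ln p') = ln y - ln x by lra.
have [xy|/ltW yx] := leP x y.
  rewrite (max_l (x := x^-1)) ?lef_pV2 ?posrE // ln_div ?posrE //.
  by rewrite ger0_norm // subr_ge0 ler_ln ?posrE.
rewrite (max_r (x := x^-1)) ?lef_pV2 ?posrE // ln_div ?posrE //.
by rewrite ler0_norm ?opprB // subr_le0 ler_ln ?posrE.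
Qed.

Lemma near_similar a b t s c : 0 < c -> bounded_distance a (comb t s) ->
  bounded_distance b (comb (c * t) (c * s)) -> roughly_similar a b.
Proof.
move=> c0 [C hC] [C' hC']; exists c, (c * `|C| + `|C'| + 1); split => //.
  by rewrite ltr_pwDr ?ltr01 // addr_ge0 // mulr_ge0 // ltW.
move=> x y; have h1 := hC x y; have h2 := hC' x y.
have {}h1 : `|a x y - comb t s x y| <= `|C| by apply: le_trans h1 (ler_norm _).
have {}h2 : `|b x y - comb (c * t) (c * s) x y| <= `|C'| by apply: le_trans h2 (ler_norm _).
have h3 : `|c * (a x y - comb t s x y)| <= c * `|C|.
  by rewrite normrM gtr0_norm // ler_pM2l.
move: h2 h3; rewrite /comb !ler_norml !mulrBr !mulrDr !mulrA.
by move=> /andP[? ?] /andP[? ?]; apply/andP; split; lra.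
Qed.

Lemma similar_near a b t s : roughly_similar a b -> bounded_distance a (comb t s) ->
  exists2 c : R, 0 < c & bounded_distance b (comb (c * t) (c * s)).
Proof.
move=> [c [C [c0 C0 hC]]] [C' hC']; exists c => //; exists (C + c * C') => x y.
have h3 : `|c * (a x y - comb t s x y)| <= c * C'.
  by rewrite normrM gtr0_norm // ler_pM2l.
have := hC x y; move: h3; rewrite /comb !ler_norml !mulrBr !mulrDr !mulrA.
by move=> /andP[? ?] /andP[? ?]; apply/andP; split; lra.
Qed.

Lemma Delta_comb a b t s t' s' : metricsD a -> metricsD b ->
  bounded_distance a (comb t s) -> bounded_distance b (comb t' s') ->
  Delta (rough_class metricsD a) (rough_class metricsD b) = `|hilbert_coord t s - hilbert_coord t' s'|.
Proof.
move=> aD bD ha hb; rewrite /Delta.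
set a' := xget _ (rough_class metricsD a); set b' := xget _ (rough_class metricsD b).
have [aD' aa] : rough_class metricsD a a' by apply: xgetPex; exists a; exact: rough_class_self.
have [bD' bb] : rough_class metricsD b b' by apply: xgetPex; exists b; exact: rough_class_self.
have [c c0 ha'] := similar_near aa ha; have [c' c0' hb'] := similar_near bb hb.
by rewrite (dil_product aD' bD' ha' hb') !hilbert_coordZ.
Qed.

Local Notation curve := (manhattan_curve ds d).

Lemma curveE t : exists2 a, metricsD a &
  bounded_distance a (comb t (theta t)) /\ curve t = rough_class metricsD a.
Proof.
have [eps [B [eps0 hB]]] := cone_coercive (theta_cone t).
have [a' a'D ha'] := metricsD_near hS hlen SW delta0 WH (comb_dominated _ _) eps0 hB.
pose P := [set dt | metricsD dt /\ bounded_distance dt (comb t (theta t))].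
have [aD ha] : P (xget (fun _ _ => 0) P) by apply: xgetPex; exists a'.
by exists (xget (fun _ _ => 0) P).
Qed.

Definition curve_coord t : R := hilbert_coord t (theta t).

Lemma Delta_curve t t' : Delta (curve t) (curve t') = `|curve_coord t - curve_coord t'|.
Proof.
have [a aD [ha ->]] := curveE t; have [b bD [hb ->]] := curveE t'.
exact: Delta_comb.
Qed.

Lemma curve_on_ray e t s a : metricsD e -> bounded_distance e (comb t s) -> 0 < a ->
  theta (a * t) = a * s -> curve (a * t) = rough_class metricsD e.
Proof.
move=> eD he a0 ha; have [b bD [hb ->]] := curveE (a * t); rewrite ha in hb.
by apply/rough_class_eq/roughly_similar_sym; exact: near_similar he hb.
Qed.

Lemma curve_through e t s : metricsD e -> bounded_distance e (comb t s) ->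
  exists a : R, [/\ 0 < a, theta (a * t) = a * s & curve (a * t) = rough_class metricsD e].
Proof.
move=> eD he; have [a a0 ha] := theta_ray (near_in_cone eD he).
by exists a; split => //; apply: (curve_on_ray eD he a0 ha).
Qed.

Lemma near_d : bounded_distance d (comb 0 1).
Proof. by exists 0 => x y; rewrite /comb mul0r mul1r add0r subrr normr0. Qed.

Lemma near_ds : bounded_distance ds (comb 1 0).
Proof. by exists 0 => x y; rewrite /comb mul0r mul1r addr0 subrr normr0. Qed.

Lemma curve0 : curve 0 = rough_class metricsD d.
Proof.
rewrite -(mulr0 (theta 0)); apply: (curve_on_ray dD near_d theta0_gt0).
by rewrite mulr0 mulr1.
Qed.

(** A geodesic starting at the class of [d] has [phi 0 = 0]: the parameter at which it
visits the point 0 of the curve is at distance 0 from the start. A combination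
in which [ds] has positive coefficient is then reached at a positive time. *)
Lemma geodesic_visits_ray phi e t s :
  (forall v : R, exists r : R, phi r = v) -> {homo phi : r r' / r < r'} ->
  (forall r r', Delta (curve (phi r)) (curve (phi r')) = `|r - r'|) ->
  curve (phi 0) = rough_class metricsD d ->
  metricsD e -> bounded_distance e (comb t s) -> 0 < t ->
  exists2 r : R, 0 < r & curve (phi r) = rough_class metricsD e.
Proof.
move=> surj mono arc start eD he t0.
have [a [a0 ha ca]] := curve_through eD he.
have [r hr] := surj (a * t); exists r; last by rewrite hr.
have [r0 hr0] := surj 0.
have r00 : r0 = 0.
  have := arc r0 0; rewrite hr0 curve0 start.
  rewrite (Delta_comb dD dD near_d near_d) subrr normr0 subr0.
  by move=> /esym/normr0_eq0.
rewrite r00 in hr0; rewrite ltNge le_eqVlt; apply/negP => /orP[/eqP e0|/mono].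
  by move: hr; rewrite e0 hr0 => /esym/eqP; rewrite gt_eqF // mulr_gt0.
by rewrite hr0 hr ltNge ltW // mulr_gt0.
Qed.

Hypothesis nsim : ~ roughly_similar ds d.

Lemma ratio_inf_lt_sup : ratio_inf < ratio_sup.
Proof.
rewrite lt_neqAle ratio_inf_le_sup andbT; apply/eqP => lh; apply: nsim.
have [|B hB] := @comb_bounded_below 1 (- ratio_inf).
  by apply: closed_cone_spectrum; rewrite -?lh; lra.
have [|B' hB'] := @comb_bounded_below (-1) ratio_inf.
  by apply: closed_cone_spectrum; rewrite -?lh; lra.
apply: roughly_similar_sym; exists ratio_inf, (`|B| + `|B'| + 1); split.
- exact: ratio_inf_gt0.
- by rewrite ltr_pwDr ?ltr01 // addr_ge0.
- move=> x y; have := hB x y; have := hB' x y; rewrite /comb.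
  have := ler_norm B; have := ler_norm B'.
  have := normr_ge0 B; have := normr_ge0 B'.
  by rewrite ler_norml => *; apply/andP; split; lra.
Qed.

(** The rays of the points of the graph turn in one direction. For [t] and [t'] of the
same sign this is [theta_scale]; for opposite signs, a positive combination of
the two points lies on the second axis, where the cone is the positive
half-line. *)
Lemma curve_coord_mono t t' : t < t' -> curve_coord t < curve_coord t'.
Proof.
move=> tt'; have [a1 a2] := theta_cone t; have [b1 b2] := theta_cone t'.
apply: (ln_quotient_lt ratio_inf_lt_sup a1 b1 a2 b2).
have [t0|t0|t0] := ltgtP t 0.
- have [t0'|t0'|t0'] := ltgtP t' 0.
  + have c1 : 1 < t / t' by rewrite ltr_ndivlMr // mul1r.
    have e1 : t / t' * t' = t by rewrite divfK // lt_eqF.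
    by have := theta_scale t' c1; rewrite e1; exact: ray_order_neg.
  + have nt0 : 0 < - t by rewrite oppr_gt0.
    have [+ _] := in_coneD (in_coneZ nt0 (theta_cone t')) (in_coneZ t0' (theta_cone t)).
    rewrite (_ : - t * t' + t' * t = 0); last by rewrite mulNr mulrC addNr.
    by rewrite mul0r add0r mulNr addrC subr_gt0.
  + by rewrite t0' mul0r nmulr_rlt0 // theta0_gt0.
- have t0' : 0 < t' := lt_trans t0 tt'.
  have c1 : 1 < t' / t by rewrite ltr_pdivlMr // mul1r.
  have e1 : t' / t * t = t' by rewrite divfK // gt_eqF.
  by have := theta_scale t c1; rewrite e1; exact: ray_order_pos.
- by rewrite t0 mul0r mulr_gt0 ?theta0_gt0 // -t0.
Qed.

Lemma curve_coord_surj v : exists t, curve_coord t = v.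
Proof.
have lh := ratio_inf_lt_sup; pose A := expR v; have A0 : 0 < A by exact: expR_gt0.
pose t := (A - 1) / (ratio_sup - ratio_inf); pose s := 1 - t * ratio_inf.
have hl0 : ratio_sup - ratio_inf != 0 by rewrite gt_eqF // subr_gt0.
have e1 : t * ratio_inf + s = 1 by rewrite /s; lra.
have e2 : t * ratio_sup + s = A.
  have : t * (ratio_sup - ratio_inf) = A - 1 by rewrite /t divfK.
  by rewrite mulrBr /s; lra.
have [|a a0 ha] := @theta_ray t s; first by split; rewrite ?e1 ?e2.
exists (a * t); rewrite /curve_coord ha hilbert_coordZ // /hilbert_coord e1 e2 divr1.
by rewrite /A expRK.
Qed.

Lemma curve_coord0 : curve_coord 0 = 0.
Proof.
by rewrite /curve_coord /hilbert_coord !mul0r !add0r divff ?ln1 // gt_eqF // theta0_gt0.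
Qed.

Lemma manhattan_geodesic_exists : exists sigma,
  is_manhattan_geodesic (rough_class metricsD ds) (rough_class metricsD d) sigma.
Proof.
have [phi [coordK phiK mono bij]] := increasing_inverse curve_coord_mono curve_coord_surj.
exists (fun r => curve (phi r)), ds, d; split.
  by split; [exact: rough_class_self|exact: rough_class_self|exists phi].
split.
- by move=> r r'; rewrite Delta_curve !phiK.
- by rewrite -curve_coord0 coordK curve0.
- rewrite (Delta_comb dD dsD near_d near_ds).
  have [a [a0 ha ca]] := curve_through dsD near_ds.
  rewrite -ca; congr (manhattan_curve ds d _); rewrite -[RHS]coordK; congr phi.
  rewrite /curve_coord ha hilbert_coordZ // /hilbert_coord !mul0r !mul1r !add0r !addr0 divff ?oner_eq0 //.
  rewrite ln1 sub0r normrN ger0_norm // ln_ge0 // ler_pdivlMr ?ratio_inf_gt0 // mul1r.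
  exact: ratio_inf_le_sup.
Qed.

End Cone.
End Pencil.

(** * Limits at infinity *)

Section Limits.
Context {R : realType} {G : groupType}.
Variables (S : set G) (len : G -> nat) (delta : R).
Hypotheses (hS : finite_symmetric_generating S) (hlen : is_word_length len).
Local Notation W := (@word_dist G R len).
Hypotheses (SW : forall x y, word_metric S x y = W x y).
Hypotheses (delta0 : 0 <= delta) (WH : four_point W delta).
Variables (h : G).
Hypotheses (h_inf : forall n, (0 < n)%N -> (h ^+ n <> 1)%g).
Hypothesis hne : ~ virtually_cyclic G.
Local Notation tl := translation_length.

Lemma translation_length_similar (d d' : G -> G -> R) (tau C : R) g :
  metricsD d -> metricsD d' -> (forall x y, `|tau * d x y - d' x y| <= C) ->
  tl d' g = tau * tl d g.
Proof.
move=> /metricsD_pm[dP dL] /metricsD_pm[dP' dL'] hC.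
rewrite (@translation_length_combination R G d' d d tau 0 C g) ?mul0r ?addr0 //.
by move=> y; rewrite mul0r addr0 distrC.
Qed.

Lemma dil_similar_le (d1 d1' d2 d2' : G -> G -> R) (tau sigma C C' : R) :
  metricsD d1 -> metricsD d1' -> metricsD d2 -> metricsD d2' ->
  0 < tau -> 0 < sigma ->
  (forall x y, `|tau * d1 x y - d1' x y| <= C) ->
  (forall x y, `|sigma * d2 x y - d2' x y| <= C') ->
  dil d1' d2' <= tau / sigma * dil d1 d2.
Proof.
move=> d1D d1D' d2D d2D' tau0 sigma0 h1 h2.
have dp := dil_gt0 hlen delta0 WH h_inf hne d1D d2D.
apply: (dil_le hlen delta0 WH h_inf hne d1D' d2D').
  by rewrite mulr_ge0 ?divr_ge0 // ltW.
move=> g; rewrite (translation_length_similar g d1D d1D' h1).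
rewrite (translation_length_similar g d2D d2D' h2).
have := ler_wpM2l (ltW tau0) (dil_ub hlen delta0 WH h_inf hne d1D d2D g).
rewrite -!mulrA (mulrCA _ sigma) (mulKf (lt0r_neq0 sigma0)).
by rewrite mulrCA.
Qed.

Lemma similarV (d d' : G -> G -> R) (tau C : R) : 0 < tau ->
  (forall x y, `|tau * d x y - d' x y| <= C) ->
  forall x y, `|tau^-1 * d' x y - d x y| <= tau^-1 * C.
Proof.
move=> tau0 hC x y.
have -> : tau^-1 * d' x y - d x y = - (tau^-1 * (tau * d x y - d' x y)).
  by rewrite mulrBr mulKf ?gt_eqF // opprB.
by rewrite normrN normrM gtr0_norm ?invr_gt0 // ler_pM2l ?invr_gt0.
Qed.

Lemma dil_similar (d1 d1' d2 d2' : G -> G -> R) (tau sigma C C' : R) :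
  metricsD d1 -> metricsD d1' -> metricsD d2 -> metricsD d2' ->
  0 < tau -> 0 < sigma ->
  (forall x y, `|tau * d1 x y - d1' x y| <= C) ->
  (forall x y, `|sigma * d2 x y - d2' x y| <= C') ->
  dil d1' d2' = tau / sigma * dil d1 d2.
Proof.
move=> d1D d1D' d2D d2D' tau0 sigma0 h1 h2; apply/eqP; rewrite eq_le.
rewrite (dil_similar_le d1D d1D' d2D d2D' tau0 sigma0 h1 h2) /=.
have := dil_similar_le d1D' d1D d2D' d2D _ _ (similarV tau0 h1) (similarV sigma0 h2).
rewrite !invr_gt0 => /(_ tau0 sigma0); rewrite -invfM mulrC.
rewrite -ler_pdivrMr ?invr_gt0 ?mulr_gt0 ?invr_gt0 //.
by rewrite invrK mulrC.
Qed.

(** The function of which [manhattan_limit] takes the class does not depend, up to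
rough similarity, on the representatives: rescaling them rescales the
dilation accordingly. *)
Lemma limit_profile_similar (ds ds' d d' : G -> G -> R) :
  metricsD ds -> metricsD ds' -> metricsD d -> metricsD d' ->
  roughly_similar ds ds' -> roughly_similar d d' ->
  roughly_similar (fun x y => dil d ds * ds x y - d x y)
    (fun x y => dil d' ds' * ds' x y - d' x y).
Proof.
move=> dsD dsD' dD dD' [sigma [C [sigma0 C0 hC]]] [tau [C' [tau0 C0' hC']]].
have E := dil_similar dD dD' dsD dsD' tau0 sigma0 hC' hC.
have dp : 0 < dil d' ds' by exact: (dil_gt0 hlen delta0 WH h_inf hne dD' dsD').
exists tau, (dil d' ds' * C + C'); split => //.
  by rewrite addr_gt0 // mulr_gt0.
move=> x y.
have -> : tau * (dil d ds * ds x y - d x y) - (dil d' ds' * ds' x y - d' x y) =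
   dil d' ds' * (sigma * ds x y - ds' x y) - (tau * d x y - d' x y).
  have -> : tau * (dil d ds * ds x y - d x y) =
      dil d' ds' * sigma * ds x y - tau * d x y.
    by rewrite E (mulrAC _ _ sigma) divfK ?gt_eqF // mulrBr mulrA.
  by rewrite mulrBr mulrA; lra.
apply: le_trans (ler_normB _ _) _; apply: lerD => //.
by rewrite normrM gtr0_norm // ler_pM2l.
Qed.

(** The property selected by [manhattan_limit]. *)
Definition is_manhattan_limit (rhostar rho rho' : set (G -> G -> R)) : Prop :=
  boundary_scrD rho' /\ exists dstar d, [/\ rhostar dstar, rho d &
    forall d', rho' d' ->
      roughly_similar d' (fun x y => dil d dstar * dstar x y - d x y)].

Lemma is_manhattan_limit_unique rhostar rho rho1 rho2 :
  scrD rhostar -> scrD rho -> is_manhattan_limit rhostar rho rho1 ->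
  is_manhattan_limit rhostar rho rho2 -> rho1 = rho2.
Proof.
move=> [ds dsD <-] [d dD <-] [[e1 e1B <-] [ds1 [d1 [[ds1D rs1] [d1D r1] h1]]]].
move=> [[e2 e2B <-] [ds2 [d2 [[ds2D rs2] [d2D r2] h2]]]].
apply: rough_class_eq.
apply: roughly_similar_trans (h1 e1 (rough_class_self e1B)) _.
apply: roughly_similar_trans (roughly_similar_sym (h2 e2 (rough_class_self e2B))).
apply: limit_profile_similar => //.
- exact: roughly_similar_trans (roughly_similar_sym rs1) rs2.
- exact: roughly_similar_trans (roughly_similar_sym r1) r2.
Qed.

Lemma comb_similar (f ds ds1 d d1 : G -> G -> R) (t s : R) :
  roughly_similar ds ds1 -> roughly_similar d d1 -> 0 < t ->
  bounded_distance f (comb ds d t s) ->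
  exists t' s' : R, 0 < t' /\ bounded_distance f (comb ds1 d1 t' s').
Proof.
move=> /roughly_similar_sym[tau [C [tau0 C0 hC]]].
move=> /roughly_similar_sym[sigma [C' [sigma0 C0' hC']]] t0 [B hB].
exists (t * tau), (s * sigma); split; first exact: mulr_gt0.
exists (B + t * C + `|s| * C') => x y.
have -> : f x y - comb ds1 d1 (t * tau) (s * sigma) x y =
    f x y - comb ds d t s x y - t * (tau * ds1 x y - ds x y)
    - s * (sigma * d1 x y - d x y).
  by rewrite /comb !mulrBr !mulrA; lra.
apply: le_trans (ler_normB _ _) _; apply: lerD; last first.
  by rewrite normrM ler_wpM2l.
apply: le_trans (ler_normB _ _) _; apply: lerD => //.
by rewrite normrM gtr0_norm // ler_pM2l.
Qed.

Section Direction.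
Variables (d e : G -> G -> R) (dD : metricsD d) (eB : boundaryD e).

Let dP := (metricsD_pm dD).1. Let dL := (metricsD_pm dD).2.
Let eP : is_pseudo_metric e. Proof. by case: eB => -[]. Qed.
Let eL : left_invariant e. Proof. by case: eB => -[]. Qed.
Let e_dom : dominated len e := closureD_dominated hlen delta0 WH eB.1.
Let d_dom := metricsD_dominated hlen delta0 WH dD.

Definition metric_sum (x y : G) : R := d x y + e x y.

Lemma boundaryD_not_coercive eps B : 0 < eps ->
  ~ (forall x y, eps * W x y - B <= e x y).
Proof.
move=> eps0 hB; case: eB => _; apply.
exact: (coercive_metricsD hS hlen SW delta0 WH eP eL e_dom eps0 hB).
Qed.

Lemma metric_sum_metricsD : metricsD metric_sum.
Proof.
have [eps [B [eps0 B0 hB]]] := metricsD_coercive hlen dD.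
have [d0 dd dC dT] := dP; have [e0 ed eC eT] := eP.
have tP : is_pseudo_metric metric_sum.
  split => [x y|x|x y|x y z]; rewrite /metric_sum.
  - exact: addr_ge0.
  - by rewrite dd ed addr0.
  - by rewrite dC eC.
  - by have := dT x y z; have := eT x y z; lra.
have tL : left_invariant metric_sum by move=> z x y; rewrite /metric_sum dL eL.
apply: (@coercive_metricsD R G S len delta hS hlen SW delta0 WH metric_sum eps B) => //.
  have -> : metric_sum = (fun x y => 1 * d x y + 1 * e x y).
    by apply/funext => x; apply/funext => y; rewrite !mul1r.
  exact: dominated_lin.
by move=> x y; apply: le_trans (hB x y) _; rewrite lerDl.
Qed.

Lemma tl_metric_sum g : tl metric_sum g = tl d g + tl e g.
Proof.
have [tP tL] := metricsD_pm metric_sum_metricsD.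
rewrite (@translation_length_combination R G metric_sum d e 1 1 0 g) ?mul1r //.
by move=> y; rewrite !mul1r subrr normr0.
Qed.

(** If the dilation were smaller than 1, then [e] would be a combination of [d + e] and
[d] inside the cone, hence coercive. *)
Lemma dil_metric_sum : dil d metric_sum = 1.
Proof.
have tD := metric_sum_metricsD.
apply/eqP; rewrite eq_le; apply/andP; split.
  apply: (dil_le hlen delta0 WH h_inf hne dD tD) => // g.
  by rewrite mul1r tl_metric_sum lerDl (translation_length_ge0 eP eL).
rewrite leNgt; apply/negP => lt1.
have lo1 : 1 < ratio_inf metric_sum d.
  by rewrite /ratio_inf invf_gt1 // (dil_gt0 hlen delta0 WH h_inf hne dD tD).
have hi1 := lt_le_trans lo1 (ratio_inf_le_sup hlen delta0 WH h_inf hne tD dD).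
have [|eps [B [eps0 hB]]] :=
    cone_coercive hlen delta0 WH h_inf hne tD dD (t := 1) (s := -1).
  by split; lra.
apply: (boundaryD_not_coercive eps0 (B := B)) => x y.
by apply: le_trans (hB x y) _; rewrite /comb /metric_sum; lra.
Qed.

Lemma metric_sum_not_similar : ~ roughly_similar metric_sum d.
Proof.
move=> /roughly_similar_sym[tau [C [tau0 C0 hC]]].
have tle g : tl e g = (tau - 1) * tl d g.
  rewrite (@translation_length_combination R G e d d (tau - 1) 0 C g) ?mul0r ?addr0 //.
  by move=> y; have := hC 1%g y; rewrite /metric_sum !ler_norml mulrBl => /andP[? ?];
    apply/andP; split; lra.
have [_ _ [x [y xy]] _] := eB.1.
have tau1 : 0 < tau - 1.
  rewrite ltNge; apply/negP => tau1.
  have tle0 g : tl e g = 0.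
    apply/eqP; rewrite eq_le (translation_length_ge0 eP eL) andbT tle.
    by apply: mulr_le0_ge0 => //; exact: translation_length_ge0.
  by move: xy; rewrite !tle0 eqxx.
have [eps [B [eps0 B0 hB]]] := metricsD_coercive hlen dD.
apply: (@boundaryD_not_coercive ((tau - 1) * eps) ((tau - 1) * B + C)).
  exact: mulr_gt0.
move=> z w; have := ler_wpM2l (ltW tau1) (hB z w); have := hC z w.
by rewrite /metric_sum ler_norml mulrBr mulrA => /andP[_]; rewrite (mulrBl (d z w)); lra.
Qed.

Lemma boundary_is_limit :
  is_manhattan_limit (rough_class metricsD metric_sum) (rough_class metricsD d)
    (rough_class boundaryD e).
Proof.
split; first by exists e.
exists metric_sum, d; split.
- exact: rough_class_self metric_sum_metricsD.
- exact: rough_class_self.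
- move=> e' [_ ee']; have -> : (fun x y => dil d metric_sum * metric_sum x y - d x y) = e.
    by apply/funext => x; apply/funext => y; rewrite dil_metric_sum mul1r /metric_sum; lra.
  exact: roughly_similar_sym.
Qed.

(** Solving [tau * e = Dil * ds' - d'] for [ds'], with [d'] a multiple of [d] and [e]
written as the difference of [d + e] and [d]. *)
Lemma limit_source_on_ray ds' d' : metricsD ds' -> metricsD d' ->
  roughly_similar d d' ->
  roughly_similar e (fun x y => dil d' ds' * ds' x y - d' x y) ->
  exists t s : R, 0 < t /\ bounded_distance ds' (comb metric_sum d t s).
Proof.
move=> dsD' dD' [sigma [C [sigma0 C0 hC]]] [tau [C' [tau0 C0' hC']]].
have dp : 0 < dil d' ds' by exact: (dil_gt0 hlen delta0 WH h_inf hne dD' dsD').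
set D := dil d' ds' in hC' dp.
exists (tau / D), ((sigma - tau) / D); split; first exact: divr_gt0.
exists ((C + C') / D) => x y; rewrite ler_pdivlMr //.
rewrite -[X in _ * X](gtr0_norm dp) -normrM mulrBl /comb /metric_sum.
rewrite mulrDl (mulrAC tau) (mulrAC (sigma - tau)) !divfK ?gt_eqF //.
have := hC x y; have := hC' x y; rewrite !ler_norml mulrBl mulrDr (mulrC D).
by move=> /andP[? ?] /andP[? ?]; apply/andP; split; lra.
Qed.

End Direction.
End Limits.

Theorem theorem5p2 (R : realType) (G : groupType)
    (hG : hyperbolic_group R G) (hne : ~ virtually_cyclic G)
    (rho rho_inf : set (G -> G -> R))
    (hrho : scrD rho) (hrho_inf : boundary_scrD rho_inf) :
  exists rho_star : set (G -> G -> R),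
    [/\ scrD rho_star,
        rho_star <> rho,
        rho_inf = manhattan_limit rho_star rho
      & forall rho'_star : set (G -> G -> R),
          scrD rho'_star ->
          rho_inf = manhattan_limit rho'_star rho ->
          (manhattan_geodesic rho_star rho @` [set t : R | 0 < t]) rho'_star].
Proof.
have [S hS Shyp] := hG.
have [len hlen [_ SW]] := word_length_exists hS.
have WP := @word_dist_pseudo_metric G R len hlen.
have {Shyp} [delta delta0 WH] :
    exists2 delta : R, 0 <= delta & four_point (@word_dist G R len) delta.
  apply: hyperbolic_four_point; first exact: pseudo_metric_sym.
  by rewrite (_ : word_dist len = word_metric S) //;
    apply/funext => x; apply/funext => y; rewrite SW.
have {}SW x y : word_metric S x y = word_dist len x y :> R by exact: SW.
case: hrho hrho_inf => d dD <- [e eB <-].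
have [h h_inf] : exists h : G, forall n, (0 < n)%N -> (h ^+ n <> 1)%g.
  have [[eP eL [x [y xy]] _] _] := eB.
  have [x0|x0] := eqVneq (translation_length e x) 0; last first.
    by exists x; exact: tl_non_torsion x0.
  by exists y; apply: (tl_non_torsion eP eL); rewrite -x0 eq_sym.
pose ds := metric_sum d e.
have dsD : metricsD ds := metric_sum_metricsD hS hlen SW delta0 WH dD eB.
have nsim := metric_sum_not_similar hS hlen SW delta0 WH dD eB.
have hlim := boundary_is_limit hS hlen SW delta0 WH h_inf hne dD eB.
have limE rs : is_manhattan_limit rs (rough_class metricsD d)
    (manhattan_limit rs (rough_class metricsD d)) \/
    manhattan_limit rs (rough_class metricsD d) = set0.
  rewrite /manhattan_limit; case: xgetP => [rho' _ ?|_]; [by left|by right].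
have scr_d : scrD (rough_class metricsD d) by exists d.
have scr_ds : scrD (rough_class metricsD ds) by exists ds.
exists (rough_class metricsD ds); split => //.
- move=> dsd; apply: nsim.
  have : rough_class metricsD d ds by rewrite -dsd; exact: rough_class_self.
  by move=> [_ /roughly_similar_sym].
- have hl : is_manhattan_limit (rough_class metricsD ds) (rough_class metricsD d)
      (manhattan_limit (rough_class metricsD ds) (rough_class metricsD d)).
    by apply: xgetPex; exists (rough_class boundaryD e).
  exact: (is_manhattan_limit_unique hlen delta0 WH h_inf hne scr_ds scr_d hlim hl).
- move=> rs' rs'D rs'lim.
  have eE : rough_class boundaryD e e by exact: rough_class_self.
  have [[_ [ds' [d' [rds' [d'D rd'] hl]]]]|l0]   := limE rs'; last first.
    by move: eE; rewrite rs'lim l0.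
  rewrite -rs'lim in hl.
  case: rs'D rds' => ds0 ds0D <- [ds'D rds'].
  have [t [s [t0 hts]]] :=
    limit_source_on_ray hlen delta0 WH h_inf hne ds'D d'D rd' (hl e eE).
  have /(xgetPex (fun=> set0)) := manhattan_geodesic_exists hS hlen SW delta0 WH
    h_inf hne dsD dD nsim.
  rewrite -/(manhattan_geodesic _ _); set sigma := manhattan_geodesic _ _.
  move=> [ds1 [d1 [[[ds1D rds1] [d1D rd1] [phi [phib phim sE]]] [arc s0 _]]]].
  have [t' [s' [t0' hts']]] := comb_similar rds1 rd1 t0 hts.
  have surj v : exists r, phi r = v.
    by case: phib => _ _ /(_ v I)[r _ <-]; exists r.
  have arc' r r' : Delta (manhattan_curve ds1 d1 (phi r))
      (manhattan_curve ds1 d1 (phi r')) = `|r - r'| by rewrite -!sE arc.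
  have start : manhattan_curve ds1 d1 (phi 0) = rough_class metricsD d1.
    by rewrite -sE s0; exact: rough_class_eq.
  have [r r0 hr] := geodesic_visits_ray hS hlen SW delta0 WH h_inf hne
    ds1D d1D surj phim arc' start ds'D hts' t0'.
  by exists r => //; rewrite sE hr; apply: rough_class_eq; exact: roughly_similar_sym.
Qed.
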